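(* Let $\lambda\in(-\pi/2,\pi/2)$. The set of extreme points of the convex set $\mathcal{P}_\lambda$ is $$\operatorname{Ext}\mathcal{P}_\lambda=\{z\mapsto p_\lambda(xz):\ |x|=1\}.$$
   Context: $\mathbb{D}$ is the open unit disc, $\mathcal{A}_0$ is the set of analytic functions $f$ on $\mathbb{D}$ with $f(0)=1$. $\mathcal{P}_\lambda=\{p\in\mathcal{A}_0:\ \operatorname{Re}(e^{i\lambda}p(z))>0 \text{ for all } z\in\mathbb{D}\}$, a convex subset of the vector space of analytic functions on $\mathbb{D}$, and $p_\lambda(z)=\dfrac{1+e^{-2i\lambda}z}{1-z}$. $\operatorname{Ext}$ denotes the set of extreme points of a convex set. *)

(* Defs.v *)
From Stdlib Require Import Reals Lra.
From Coquelicot Require Import Coquelicot.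

Open Scope R_scope.
Open Scope C_scope.

Definition unit_disc : Type := {z : C | (Cmod z < 1)%R}.

Definition unit_disc_val (z : unit_disc) : C := proj1_sig z.
Coercion unit_disc_val : unit_disc >-> C.

Lemma unit_disc0_proof : (Cmod 0 < 1)%R.
Proof. rewrite Cmod_0; exact Rlt_0_1. Qed.

Definition unit_disc0 : unit_disc := exist _ (RtoC 0) unit_disc0_proof.

(* Coquelicot differentiates functions defined on all of C. As the disc is open,
   complex differentiability at a point of the disc does not depend on the
   extension F. *)
Definition analytic (f : unit_disc -> C) : Prop :=
  exists F : C -> C,
    (forall z : unit_disc, F z = f z) /\
    (forall z : unit_disc, ex_derive (K := C_AbsRing) (V := C_NormedModule) F (unit_disc_val z)).

Definition A0 (f : unit_disc -> C) : Prop := analytic f /\ f unit_disc0 = 1.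

(* e^{it} for real t; Coquelicot has no complex exponential. *)
Definition expi (t : R) : C := (cos t, sin t).

Definition P_lambda (lam : R) (p : unit_disc -> C) : Prop :=
  A0 p /\ forall z : unit_disc, (0 < Re (expi lam * p z))%R.

Definition p_lambda (lam : R) (z : C) : C := (1 + expi (-2 * lam)%R * z) / (1 - z).

Definition combination {X : Type} (t : R) (g h : X -> C) : X -> C :=
  fun z => RtoC t * g z + RtoC (1 - t) * h z.

Definition convex {X : Type} (K : (X -> C) -> Prop) : Prop :=
  forall (g h : X -> C) (t : R),
    K g -> K h -> (0 <= t <= 1)%R -> K (combination t g h).

Definition Ext {X : Type} (K : (X -> C) -> Prop) (f : X -> C) : Prop :=
  K f /\
  forall (g h : X -> C) (t : R),
    K g -> K h -> (0 < t < 1)%R -> f = combination t g h -> g = h.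

Lemma is_derive_scal_C (F : C -> C) (z k l : C) :
  is_derive (K := C_AbsRing) (V := C_NormedModule) F z l ->
  is_derive (K := C_AbsRing) (V := C_NormedModule) (fun w => k * F w) z (k * l).
Proof.
intros HF.
apply (filterdiff_ext_lin (K := C_AbsRing) (U := AbsRing_NormedModule C_AbsRing)
         (V := C_NormedModule) (F := locally (T := AbsRing_UniformSpace C_AbsRing) z)
         (fun w => k * F w)
         (fun y : C => k * (y * l)) (fun y : C => y * (k * l))).
- exact (filterdiff_scal_r_fct (K := C_AbsRing) (U := AbsRing_NormedModule C_AbsRing)
           (V := C_NormedModule) (F := locally (T := AbsRing_UniformSpace C_AbsRing) z)
           (FF := _) k F (fun y : C => y * l) Cmult_comm HF).
- intros y; change (k * (y * l) = y * (k * l)); ring.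
Qed.

Lemma convex_P_lambda (lam : R) : convex (P_lambda lam).
Proof.
intros g h t [[[G [Gg dG]] g0] rg] [[[H [Hh dH]] h0] rh] Ht.
split; [split|].
- exists (fun z => RtoC t * G z + RtoC (1 - t) * H z); split.
  + intros z; unfold combination; now rewrite Gg, Hh.
  + intros z.
    destruct (dG z) as [G' HG]; destruct (dH z) as [H' HH].
    eexists.
    apply (is_derive_plus (K := C_AbsRing) (V := C_NormedModule)
             (fun z => RtoC t * G z) (fun z => RtoC (1 - t) * H z)).
    * exact (is_derive_scal_C G _ (RtoC t) G' HG).
    * exact (is_derive_scal_C H _ (RtoC (1 - t)) H' HH).
- unfold combination; rewrite g0, h0, RtoC_minus; ring.
- intros z.
  replace (Re (expi lam * combination t g h z))
    with (t * Re (expi lam * g z) + (1 - t) * Re (expi lam * h z))%R.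
  + specialize (rg z); specialize (rh z).
    destruct (Req_dec t 0) as [->|nt]; [lra|].
    apply Rplus_lt_le_0_compat.
    * apply Rmult_lt_0_compat; lra.
    * apply Rmult_le_pos; lra.
  + unfold combination, expi, Re; destruct (g z), (h z); simpl; ring.
Qed.

(* Main.v *)
Require Import Defs.
From Stdlib Require Import Reals Lra Lia List.
From Stdlib Require Import Classical ClassicalEpsilon FunctionalExtensionality.
From Coquelicot Require Import Coquelicot.
Import ListNotations.
Local Open Scope C_scope.
Local Open Scope R_scope.

(** Write [e] for [expi lam]. The class [P_lambda lam] is parametrised by Schur
    functions: [f] belongs to it exactly when [f z = p_lambda lam (z * w z)] for
    some [w] holomorphic on the disc with [|w| <= 1]. Indeed
    [(f - 1) / (f + e^(-2))] maps the disc to itself and vanishes at 0, so [w] is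
    what the Schwarz lemma provides ([schwarz], [P_lambda_schur]). In terms of [w]
    both inclusions become computations at each point of the disc, and no integral
    representation is needed.

    The kernels are extreme ([kernel_extreme]): every [f] in the class satisfies
    [|f z - 1| <= |z| |f z + e^(-2)|], which confines [f z] to a disc, and the
    kernel [p_lambda lam (x * z)] with [|x| = 1] lies on the bounding circle at
    every [z]. Discs are strictly convex, so a proper convex combination of values
    in the disc reaches the circle only if the values agree.

    There are no others ([extreme_variation_0]). For [|a| = 1] the function
    [variation a (w 0) z (w z)] vanishes at 0 and its real part is dominated by a
    multiple of [Re (e * f z)]; adding or subtracting a small multiple of it keeps
    [f] inside the class, so for an extreme [f] it must vanish identically. The
    cases [a = 1] and [a = i] of this identity together say that [w] is constant
    and that [|w 0| = 1], hence [f] is a kernel.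

    The rest supplies the function theory behind the Schwarz lemma for functions
    that are merely complex differentiable at each point. Goursat's bisection
    argument ([goursat]), applied to [G (z0 + exp w)] on a rectangle of height
    [2 * PI], shows that the mean of [Re G] over circles centred at [z0] does not
    depend on the radius. This forbids a quadratic peak of [Re G]
    ([no_quadratic_peak]), and the maximum principle follows by perturbing with a
    small multiple of [|z|^2] ([max_Re], [max_modulus]). The function [w] has
    also to be differentiable at 0, and this comes from the maximum principle too,
    applied to divided differences ([removable_singularity]). *)

(** * Bisection of rectangles *)

Record box := Box { xmin : R; xmax : R; ymin : R; ymax : R }.

Definition subbox (B B' : box) : Prop :=
  xmin B' <= xmin B /\ xmax B <= xmax B' /\ ymin B' <= ymin B /\ ymax B <= ymax B'.

Definition width (B : box) : R := xmax B - xmin B.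
Definition height (B : box) : R := ymax B - ymin B.
Definition xmid (B : box) : R := (xmin B + xmax B) / 2.
Definition ymid (B : box) : R := (ymin B + ymax B) / 2.
Definition quarter_sw (B : box) : box := Box (xmin B) (xmid B) (ymin B) (ymid B).
Definition quarter_se (B : box) : box := Box (xmid B) (xmax B) (ymin B) (ymid B).
Definition quarter_nw (B : box) : box := Box (xmin B) (xmid B) (ymid B) (ymax B).
Definition quarter_ne (B : box) : box := Box (xmid B) (xmax B) (ymid B) (ymax B).

Definition in_box (z : C) (B : box) : Prop :=
  xmin B <= Re z <= xmax B /\ ymin B <= Im z <= ymax B.

(** A property that always passes to one of the four quarters concentrates at a
    point. Both Goursat's theorem (the property being a large contour integral) and
    the existence of maxima on a disc rest on this. *)
Lemma bisection (P : box -> Prop) (B0 : box) :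
  0 < width B0 -> 0 < height B0 -> P B0 ->
  (forall B, subbox B B0 -> 0 < width B -> 0 < height B -> P B ->
     P (quarter_sw B) \/ P (quarter_se B) \/ P (quarter_nw B) \/ P (quarter_ne B)) ->
  exists z, in_box z B0 /\
    forall d, 0 < d -> exists B, subbox B B0 /\ in_box z B /\ P B /\
      0 < width B < d /\ 0 < height B < d.
Proof.
intros w0 h0 P0 Hstep.
set (good := fun B => subbox B B0 /\ 0 < width B /\ 0 < height B /\ P B).
assert (Hnext : forall B, exists B', good B ->
    good B' /\ subbox B' B /\ width B' = width B / 2 /\ height B' = height B / 2).
{ intros B.
  destruct (classic (good B)) as [[sB [wB [hB PB]]]|n]; [|exists B; tauto].
  destruct (Hstep B sB wB hB PB) as [H|[H|[H|H]]];
    [exists (quarter_sw B)|exists (quarter_se B)|exists (quarter_nw B)|exists (quarter_ne B)];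
    intros _; unfold good, subbox, width, height, xmid, ymid in *; simpl in *;
    unfold xmid, ymid in *; repeat split; try assumption; lra. }
set (next := fun B => proj1_sig (constructive_indefinite_description _ (Hnext B))).
assert (nextP : forall B, good B ->
    good (next B) /\ subbox (next B) B /\ width (next B) = width B / 2 /\ height (next B) = height B / 2).
{ intros B; unfold next; destruct constructive_indefinite_description as [B' H']; exact H'. }
set (S := fun n => Nat.iter n next B0).
assert (Sgood : forall n, good (S n)).
{ induction n as [|n IH]; [|exact (proj1 (nextP _ IH))].
  split; [|tauto].
  unfold subbox; simpl; repeat split; apply Rle_refl. }
assert (Sdim : forall n, width (S n) = width B0 * (/ 2) ^ n /\ height (S n) = height B0 * (/ 2) ^ n).
{ induction n as [|n [IHw IHh]]; [split; unfold S; simpl; ring|].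
  destruct (nextP _ (Sgood n)) as [_ [_ [ew eh]]].
  change (S (Datatypes.S n)) with (next (S n)); rewrite ew, eh, IHw, IHh; simpl; split; field. }
assert (Ssub : forall n k, subbox (S (k + n)%nat) (S n)).
{ intros n; induction k as [|k IH]; [unfold subbox; repeat split; apply Rle_refl|].
  destruct (nextP _ (Sgood (k + n)%nat)) as [_ [s _]].
  change (S (Datatypes.S k + n)%nat) with (next (S (k + n)%nat)).
  unfold subbox in *; repeat split; lra. }
assert (Scross : forall n m, xmin (S n) <= xmax (S m) /\ ymin (S n) <= ymax (S m)).
{ intros n m.
  assert (H1 := Ssub n m); assert (H2 := Ssub m n).
  rewrite (Nat.add_comm n m) in H2.
  destruct (Sgood (m + n)%nat) as [_ [w [h _]]].
  unfold subbox, width, height in *; split; lra. }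
assert (lub : forall lo hi : box -> R, (forall n m, lo (S n) <= hi (S m)) ->
    exists x, forall n, lo (S n) <= x <= hi (S n)).
{ intros lo hi Hc.
  destruct (completeness (fun x => exists n, x = lo (S n))) as [x [Hub Hlub]].
  - exists (hi (S 0%nat)); intros x [n ->]; apply Hc.
  - exists (lo (S 0%nat)), 0%nat; reflexivity.
  - exists x; intros n; split; [apply Hub; now exists n|].
    apply Hlub; intros y [m ->]; apply Hc. }
destruct (lub xmin xmax) as [x Hx]; [intros; apply Scross|].
destruct (lub ymin ymax) as [y Hy]; [intros; apply Scross|].
exists (x, y); split; [exact (conj (Hx 0%nat) (Hy 0%nat))|].
intros d Hd.
assert (Hn : exists n, width (S n) < d /\ height (S n) < d).
{ destruct (pow_lt_1_zero (/ 2)) with (y := d / (width B0 + height B0)) as [n Hn].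
  - rewrite Rabs_pos_eq; lra.
  - apply Rdiv_lt_0_compat; lra.
  - exists n; destruct (Sdim n) as [-> ->].
    specialize (Hn n (le_n _)); rewrite Rabs_pos_eq in Hn by (apply pow_le; lra).
    apply Rlt_div_r in Hn; [|lra].
    assert (0 < (/ 2) ^ n) by (apply pow_lt; lra); split; nra. }
destruct Hn as [n [Hw Hh]]; destruct (Sgood n) as [sB [wB [hB PB]]].
exists (S n); split; [exact sB|split; [exact (conj (Hx n) (Hy n))|]].
repeat split; assumption.
Qed.

(** * Continuity and complex differentiability *)

(** Continuity for the uniform structure given by the modulus, in the domain as
    well as in the codomain; the product structure of [C] has the same continuous
    maps, but the library lemmas on products in a ring do not apply to it. *)
Definition ccont (f : C -> C) (z : C) : Prop :=
  @continuous (AbsRing_UniformSpace C_AbsRing) (AbsRing_UniformSpace C_AbsRing) f z.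

Lemma ccont_eps (f : C -> C) (z : C) :
  ccont f z <-> forall e, 0 < e -> exists d, 0 < d /\
    forall w, Cmod (w - z) < d -> Cmod (f w - f z) < e.
Proof.
split.
- intros H e He.
  destruct (proj1 (@filterlim_locally _ (AbsRing_UniformSpace C_AbsRing) _ _ f (f z)) H (mkposreal e He)) as [d Hd].
  exists d; split; [apply cond_pos|]; intros w Hw; exact (Hd w Hw).
- intros H; apply (proj2 (@filterlim_locally _ (AbsRing_UniformSpace C_AbsRing) _ _ f (f z))); intros e.
  destruct (H e (cond_pos e)) as [d [Hd H']].
  exists (mkposreal d Hd); intros w Hw; exact (H' w Hw).
Qed.

Lemma ccont_local (f g : C -> C) (z : C) (d : R) :
  0 < d -> (forall w, Cmod (w - z) < d -> f w = g w) -> ccont f z -> ccont g z.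
Proof.
intros Hd E Hf; apply (@continuous_ext_loc (AbsRing_UniformSpace C_AbsRing) (AbsRing_UniformSpace C_AbsRing)
         g f z); [|exact Hf].
exists (mkposreal d Hd); intros w Hw; exact (E w Hw).
Qed.

Lemma ccont_const (k z : C) : ccont (fun _ => k) z.
Proof. apply (@continuous_const (AbsRing_UniformSpace C_AbsRing) (AbsRing_UniformSpace C_AbsRing)). Qed.

Lemma ccont_id (z : C) : ccont (fun w => w) z.
Proof. apply (@continuous_id (AbsRing_UniformSpace C_AbsRing)). Qed.

Lemma ccont_plus (f g : C -> C) (z : C) :
  ccont f z -> ccont g z -> ccont (fun w => (f w + g w)%C) z.
Proof.
apply (@continuous_plus (AbsRing_UniformSpace C_AbsRing) C_AbsRing (AbsRing_NormedModule C_AbsRing)).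
Qed.

Lemma ccont_mult (f g : C -> C) (z : C) :
  ccont f z -> ccont g z -> ccont (fun w => (f w * g w)%C) z.
Proof. apply (@continuous_mult (AbsRing_UniformSpace C_AbsRing) C_AbsRing). Qed.

Lemma ccont_opp (f : C -> C) (z : C) : ccont f z -> ccont (fun w => (- f w)%C) z.
Proof.
intros Hf; apply (ccont_local (fun w => (- (1) * f w)%C) _ _ 1 Rlt_0_1).
- intros w _; ring.
- apply ccont_mult; [apply ccont_const|exact Hf].
Qed.

Lemma ccont_minus (f g : C -> C) (z : C) :
  ccont f z -> ccont g z -> ccont (fun w => (f w - g w)%C) z.
Proof. intros Hf Hg; apply ccont_plus; [exact Hf|apply ccont_opp, Hg]. Qed.

Lemma ccont_comp (f g : C -> C) (z : C) :
  ccont f z -> ccont g (f z) -> ccont (fun w => g (f w)) z.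
Proof.
apply (@continuous_comp (AbsRing_UniformSpace C_AbsRing) (AbsRing_UniformSpace C_AbsRing)
         (AbsRing_UniformSpace C_AbsRing)).
Qed.

Lemma Cminus_diag (z : C) : (z - z)%C = 0%C.
Proof. ring. Qed.

Lemma Cmod_minus_sym (a b : C) : Cmod (a - b) = Cmod (b - a).
Proof. rewrite <- Cmod_opp; f_equal; ring. Qed.

Lemma Cmod_sub_ge (a b : C) : Cmod a - Cmod b <= Cmod (a - b).
Proof.
assert (H := Cmod_triangle (a - b) b).
replace (a - b + b)%C with a in H by ring; lra.
Qed.

Lemma Cmod_sub_le (a b : C) : Cmod (a - b) <= Cmod a + Cmod b.
Proof. rewrite <- (Cmod_opp b); apply Cmod_triangle. Qed.

Lemma Cminus_neq0 (a b : C) : a <> b -> (a - b)%C <> 0%C.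
Proof. intros n E; apply n; replace a with (a - b + b)%C by ring; rewrite E; ring. Qed.

Lemma Cmod_sub_gt0 (a b : C) : a <> b -> 0 < Cmod (a - b).
Proof. intros n; apply Cmod_gt_0, Cminus_neq0, n. Qed.

Lemma ccont_neq0 (f : C -> C) (z : C) : ccont f z -> f z <> 0%C ->
  exists d, 0 < d /\ forall w, Cmod (w - z) < d -> Cmod (f z) / 2 < Cmod (f w).
Proof.
intros Hf n; apply Cmod_gt_0 in n.
destruct (proj1 (ccont_eps f z) Hf (Cmod (f z) / 2)) as [d [Hd H]]; [lra|].
exists d; split; [exact Hd|]; intros w Hw; specialize (H w Hw).
rewrite Cmod_minus_sym in H; assert (T := Cmod_sub_ge (f z) (f w)); lra.
Qed.

Lemma ccont_inv (f : C -> C) (z : C) : ccont f z -> f z <> 0%C -> ccont (fun w => (/ f w)%C) z.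
Proof.
intros Hf n; assert (p := proj1 (Cmod_gt_0 _) n).
destruct (ccont_neq0 f z Hf n) as [d1 [Hd1 H1]].
apply ccont_eps; intros e He.
destruct (proj1 (ccont_eps f z) Hf (e * (Cmod (f z) / 2 * Cmod (f z)))) as [d2 [Hd2 H2]].
{ apply Rmult_lt_0_compat; [exact He|nra]. }
exists (Rmin d1 d2); split; [now apply Rmin_glb_lt|]; intros w Hw.
specialize (H1 w (Rlt_le_trans _ _ _ Hw (Rmin_l _ _))).
specialize (H2 w (Rlt_le_trans _ _ _ Hw (Rmin_r _ _))).
assert (nw : f w <> 0%C) by (apply Cmod_gt_0; lra).
replace (/ f w - / f z)%C with ((f z - f w) / (f w * f z))%C by (field; auto).
rewrite Cmod_div, Cmod_mult, Cmod_minus_sym by (apply Cmult_neq_0; auto).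
apply Rlt_div_l; [nra|]. apply (Rlt_le_trans _ _ _ H2); apply Rmult_le_compat_l; nra.
Qed.

(** Caratheodory's form of differentiability: the difference quotient extends
    continuously to [z]. Algebraic rules become identities between quotients, and
    the quotient [q] itself, which is holomorphic wherever [f] is except possibly at
    [z], is what the Schwarz lemma and divided differences need. *)
Definition cdiff (f : C -> C) (z : C) : Prop :=
  exists q, ccont q z /\ forall w, f w = (f z + q w * (w - z))%C.

Lemma cdiff_ccont (f : C -> C) (z : C) : cdiff f z -> ccont f z.
Proof.
intros [q [Hq E]].
apply (ccont_local (fun w => (f z + q w * (w - z))%C) _ _ 1 Rlt_0_1); [auto|].
apply ccont_plus; [apply ccont_const|apply ccont_mult; [exact Hq|]].
apply ccont_minus; [apply ccont_id|apply ccont_const].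
Qed.

Lemma cdiff_local (f g : C -> C) (z : C) (d : R) :
  0 < d -> (forall w, Cmod (w - z) < d -> f w = g w) -> cdiff f z -> cdiff g z.
Proof.
intros Hd E [q [Hq Ef]].
exists (fun w => if excluded_middle_informative (w = z) then q z else ((g w - g z) / (w - z))%C).
assert (Ez : f z = g z) by (apply E; now rewrite Cminus_diag, Cmod_0).
split.
- apply (ccont_local q _ _ d Hd); [|exact Hq]; intros w Hw.
  destruct excluded_middle_informative as [->|n]; [reflexivity|].
  rewrite <- Ez, <- (E w Hw), (Ef w); field; now apply Cminus_neq0.
- intros w; destruct excluded_middle_informative as [->|n]; [ring|].
  field; now apply Cminus_neq0.
Qed.

Lemma cdiff_const (k z : C) : cdiff (fun _ => k) z.
Proof. exists (fun _ => 0%C); split; [apply ccont_const|intros; ring]. Qed.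

Lemma cdiff_id (z : C) : cdiff (fun w => w) z.
Proof. exists (fun _ => 1%C); split; [apply ccont_const|intros; ring]. Qed.

Lemma cdiff_plus (f g : C -> C) (z : C) :
  cdiff f z -> cdiff g z -> cdiff (fun w => (f w + g w)%C) z.
Proof.
intros [p [Hp Ef]] [q [Hq Eg]]; exists (fun w => (p w + q w)%C).
split; [now apply ccont_plus|]; intros w; rewrite (Ef w), (Eg w); ring.
Qed.

Lemma cdiff_mult (f g : C -> C) (z : C) :
  cdiff f z -> cdiff g z -> cdiff (fun w => (f w * g w)%C) z.
Proof.
intros [p [Hp Ef]] Hg; assert (Hg' := cdiff_ccont _ _ Hg); destruct Hg as [q [Hq Eg]].
exists (fun w => (p w * g w + f z * q w)%C); split.
- apply ccont_plus; apply ccont_mult; auto using ccont_const.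
- intros w; rewrite (Ef w), (Eg w); ring.
Qed.

Lemma cdiff_opp (f : C -> C) (z : C) : cdiff f z -> cdiff (fun w => (- f w)%C) z.
Proof.
intros [p [Hp Ef]]; exists (fun w => (- p w)%C).
split; [now apply ccont_opp|]; intros w; rewrite (Ef w); ring.
Qed.

Lemma cdiff_minus (f g : C -> C) (z : C) :
  cdiff f z -> cdiff g z -> cdiff (fun w => (f w - g w)%C) z.
Proof. intros Hf Hg; apply cdiff_plus; [exact Hf|apply cdiff_opp, Hg]. Qed.

Lemma cdiff_comp (f g : C -> C) (z : C) :
  cdiff f z -> cdiff g (f z) -> cdiff (fun w => g (f w)) z.
Proof.
intros Hf [q [Hq Eg]]; assert (Hf' := cdiff_ccont _ _ Hf); destruct Hf as [p [Hp Ef]].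
exists (fun w => (q (f w) * p w)%C); split.
- apply ccont_mult; [now apply ccont_comp|exact Hp].
- intros w; rewrite (Eg (f w)); rewrite (Ef w) at 2; ring.
Qed.

Lemma cdiff_inv (f : C -> C) (z : C) : cdiff f z -> f z <> 0%C -> cdiff (fun w => (/ f w)%C) z.
Proof.
intros Hf n; apply (cdiff_comp f Cinv); [exact Hf|]; clear Hf.
revert n; generalize (f z); clear f z; intros z n.
destruct (ccont_neq0 _ z (ccont_id z) n) as [d [Hd H]].
assert (nw : forall w, Cmod (w - z) < d -> w <> 0%C).
{ intros w Hw; apply Cmod_gt_0; specialize (H w Hw); assert (T := Cmod_ge_0 z); lra. }
exists (fun w => if excluded_middle_informative (w = z) then (- / (z * z))%C
                 else ((/ w - / z) / (w - z))%C); split.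
- apply (ccont_local (fun w => (- / (w * z))%C) _ _ d Hd).
  + intros w Hw; specialize (nw w Hw); destruct excluded_middle_informative as [->|n']; [reflexivity|].
    apply Cminus_neq0 in n'; field; auto.
  + apply ccont_opp, (ccont_inv (fun w => (w * z)%C)); [|now apply Cmult_neq_0].
    apply ccont_mult; [apply ccont_id|apply ccont_const].
- intros w; destruct excluded_middle_informative as [->|n']; [ring|].
  apply Cminus_neq0 in n'; unfold Cdiv; rewrite <- Cmult_assoc, (Cmult_comm (/ (w - z))), Cinv_r by exact n'.
  ring.
Qed.

Lemma cdiff_div (f g : C -> C) (z : C) :
  cdiff f z -> cdiff g z -> g z <> 0%C -> cdiff (fun w => (f w / g w)%C) z.
Proof. intros Hf Hg n; apply cdiff_mult; [exact Hf|now apply cdiff_inv]. Qed.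

Lemma cdiff_pow (f : C -> C) (z : C) (n : nat) : cdiff f z -> cdiff (fun w => (f w ^ n)%C) z.
Proof.
intros Hf; induction n as [|n IH]; [exact (cdiff_const 1 z)|exact (cdiff_mult _ _ _ Hf IH)].
Qed.

Lemma ccont_pow (f : C -> C) (z : C) (n : nat) : ccont f z -> ccont (fun w => (f w ^ n)%C) z.
Proof.
intros Hf; induction n as [|n IH]; [exact (ccont_const 1 z)|exact (ccont_mult _ _ _ Hf IH)].
Qed.

Lemma ccont_slope (f q : C -> C) (a z : C) :
  (forall w, f w = (f a + q w * (w - a))%C) -> z <> a -> ccont f z -> ccont q z.
Proof.
intros E n Hf.
apply (ccont_local (fun w => ((f w - f a) * / (w - a))%C) _ _ (Cmod (z - a)) (Cmod_sub_gt0 _ _ n)).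
- intros w Hw; rewrite (E w); field; apply Cminus_neq0; intros ->.
  rewrite Cmod_minus_sym in Hw; lra.
- apply ccont_mult; [apply ccont_minus; [exact Hf|apply ccont_const]|].
  apply (ccont_inv (fun w => (w - a)%C)); [|now apply Cminus_neq0].
  apply ccont_minus; [apply ccont_id|apply ccont_const].
Qed.

Lemma cdiff_slope (f q : C -> C) (a z : C) :
  (forall w, f w = (f a + q w * (w - a))%C) -> z <> a -> cdiff f z -> cdiff q z.
Proof.
intros E n Hf.
apply (cdiff_local (fun w => ((f w - f a) / (w - a))%C) _ _ (Cmod (z - a)) (Cmod_sub_gt0 _ _ n)).
- intros w Hw; rewrite (E w); field; apply Cminus_neq0; intros ->.
  rewrite Cmod_minus_sym in Hw; lra.
- apply cdiff_div; [| |now apply Cminus_neq0]; apply cdiff_minus; auto using cdiff_const, cdiff_id.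
Qed.

Lemma cdiff_ex_derive (f : C -> C) (z : C) :
  cdiff f z <-> ex_derive (K := C_AbsRing) (V := C_NormedModule) f z.
Proof.
split.
- intros [q [Hq E]]; exists (q z).
  split; [apply (is_linear_scal_l (K:=C_AbsRing) (V:=C_NormedModule) (q z))|].
  intros x Hx e.
  assert (x = z) as ->.
  { symmetry; apply (is_filter_lim_locally_unique (K:=C_AbsRing) (V:=AbsRing_NormedModule C_AbsRing) z x Hx). }
  destruct (proj1 (ccont_eps q z) Hq e (cond_pos e)) as [d [Hd H]].
  exists (mkposreal d Hd); intros w Hw; specialize (H w Hw).
  change (Cmod ((f w - f z) - (w - z) * q z) <= e * Cmod (w - z)).
  replace (f w - f z - (w - z) * q z)%C with ((q w - q z) * (w - z))%C by (rewrite (E w); ring).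
  rewrite Cmod_mult; apply Rmult_le_compat_r; [apply Cmod_ge_0|lra].
- intros [l [_ H]].
  specialize (H z (fun P H => H)).
  exists (fun w => if excluded_middle_informative (w = z) then l else ((f w - f z) / (w - z))%C); split.
  + apply ccont_eps; intros e He.
    assert (He2 : 0 < e / 2) by lra.
    destruct (H (mkposreal _ He2)) as [d Hd].
    exists d; split; [apply cond_pos|]; intros w Hw.
    specialize (Hd w Hw).
    change (Cmod ((f w - f z) - (w - z) * l) <= e / 2 * Cmod (w - z)) in Hd.
    destruct (excluded_middle_informative (z = z)) as [_|n]; [|easy].
    destruct (excluded_middle_informative (w = z)) as [->|n].
    * rewrite Cminus_diag, Cmod_0; exact He.
    * replace ((f w - f z) / (w - z) - l)%C with (((f w - f z) - (w - z) * l) / (w - z))%C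
        by (field; now apply Cminus_neq0).
      rewrite Cmod_div by now apply Cminus_neq0.
      apply Rlt_div_l; [now apply Cmod_sub_gt0|].
      apply (Rle_lt_trans _ _ _ Hd), Rmult_lt_compat_r; [now apply Cmod_sub_gt0|lra].
  + intros w; destruct excluded_middle_informative as [->|n]; [ring|].
    field; now apply Cminus_neq0.
Qed.

(** * Goursat's theorem on rectangles *)

Lemma im_le_Cmod (z : C) : Rabs (Im z) <= Cmod z.
Proof. exact (Rle_trans _ _ _ (Rmax_r _ _) (Rmax_Cmod z)). Qed.

Lemma Cmod_le_Re_Im (z : C) : Cmod z <= Rabs (Re z) + Rabs (Im z).
Proof.
replace z with (RtoC (Re z) + Ci * RtoC (Im z))%C at 1
  by (destruct z; unfold RtoC, Ci, Cplus, Cmult; simpl; f_equal; ring).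
apply (Rle_trans _ _ _ (Cmod_triangle _ _)).
rewrite Cmod_mult, Cmod_Ci, !Cmod_R; lra.
Qed.

Lemma continuous_hline (H : C -> C) (s c : R) :
  ccont H (s, c) -> continuous (fun s => Im (H (s, c))) s.
Proof.
intros Hc; apply (proj2 (filterlim_locally _ _)); intros e.
destruct (proj1 (ccont_eps _ _) Hc e (cond_pos e)) as [d [Hd E]].
exists (mkposreal d Hd); intros s' Hs'; change (Rabs (s' - s) < d) in Hs'.
change (Rabs (Im (H (s', c)) - Im (H (s, c))) < e).
apply (Rle_lt_trans _ _ _ (im_le_Cmod (H (s', c) - H (s, c))%C)), E.
apply (Rle_lt_trans _ _ _ (Cmod_le_Re_Im _)); simpl.
replace (c + - c) with 0 by ring; rewrite Rabs_R0, Rplus_0_r; exact Hs'.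
Qed.

Lemma continuous_vline (H : C -> C) (c t : R) :
  ccont H (c, t) -> continuous (fun t => Re (H (c, t))) t.
Proof.
intros Hc; apply (proj2 (filterlim_locally _ _)); intros e.
destruct (proj1 (ccont_eps _ _) Hc e (cond_pos e)) as [d [Hd E]].
exists (mkposreal d Hd); intros t' Ht'; change (Rabs (t' - t) < d) in Ht'.
change (Rabs (Re (H (c, t')) - Re (H (c, t))) < e).
apply (Rle_lt_trans _ _ _ (re_le_Cmod (H (c, t') - H (c, t))%C)), E.
apply (Rle_lt_trans _ _ _ (Cmod_le_Re_Im _)); simpl.
replace (c + - c) with 0 by ring; rewrite Rabs_R0, Rplus_0_l; exact Ht'.
Qed.

(** Imaginary part of the counterclockwise integral of [H] along the boundary. It
    suffices
    because the final use compares only means of real parts on vertical sides. *)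
Definition contour (H : C -> C) (B : box) : R :=
  RInt (fun s => Im (H (s, ymin B))) (xmin B) (xmax B)
  - RInt (fun s => Im (H (s, ymax B))) (xmin B) (xmax B)
  + RInt (fun t => Re (H (xmax B, t))) (ymin B) (ymax B)
  - RInt (fun t => Re (H (xmin B, t))) (ymin B) (ymax B).

Lemma ex_RInt_hline (H : C -> C) (a b c : R) : a <= b ->
  (forall s, a <= s <= b -> ccont H (s, c)) -> ex_RInt (fun s => Im (H (s, c))) a b.
Proof.
intros ab Hc; apply (ex_RInt_continuous (V := R_CompleteNormedModule)); intros s Hs.
rewrite Rmin_left, Rmax_right in Hs by exact ab; now apply continuous_hline, Hc.
Qed.

Lemma ex_RInt_vline (H : C -> C) (a b c : R) : a <= b ->
  (forall t, a <= t <= b -> ccont H (c, t)) -> ex_RInt (fun t => Re (H (c, t))) a b.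
Proof.
intros ab Hc; apply (ex_RInt_continuous (V := R_CompleteNormedModule)); intros s Hs.
rewrite Rmin_left, Rmax_right in Hs by exact ab; now apply continuous_vline, Hc.
Qed.

Lemma RInt_split (g : R -> R) (a m b : R) : a <= m <= b -> ex_RInt g a b ->
  RInt g a b = RInt g a m + RInt g m b.
Proof.
intros Hm Hg; symmetry; apply (RInt_Chasles (V := R_CompleteNormedModule)).
- now apply (ex_RInt_Chasles_1 (V := R_CompleteNormedModule) g a m b).
- now apply (ex_RInt_Chasles_2 (V := R_CompleteNormedModule) g a m b).
Qed.

Lemma contour_quarters (H : C -> C) (B : box) : 0 < width B -> 0 < height B ->
  (forall z, in_box z B -> ccont H z) ->
  contour H B = contour H (quarter_sw B) + contour H (quarter_se B)
              + contour H (quarter_nw B) + contour H (quarter_ne B).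
Proof.
destruct B as [a b c d]; unfold width, height, contour, quarter_sw, quarter_se, quarter_nw, quarter_ne, xmid, ymid; simpl.
intros ab cd Hc.
set (m := (a + b) / 2); set (n := (c + d) / 2).
assert (am : a <= m <= b) by (unfold m; lra).
assert (cn : c <= n <= d) by (unfold n; lra).
assert (Sh : forall y, c <= y <= d -> RInt (fun s => Im (H (s, y))) a b
   = RInt (fun s => Im (H (s, y))) a m + RInt (fun s => Im (H (s, y))) m b).
{ intros y Hy; apply RInt_split; [exact am|]; apply ex_RInt_hline; [lra|].
  intros s Hs; apply Hc; now split. }
assert (Sv : forall x, a <= x <= b -> RInt (fun t => Re (H (x, t))) c d
   = RInt (fun t => Re (H (x, t))) c n + RInt (fun t => Re (H (x, t))) n d).
{ intros x Hx; apply RInt_split; [exact cn|]; apply ex_RInt_vline; [lra|].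
  intros s Hs; apply Hc; now split. }
rewrite (Sh c), (Sh d), (Sv a), (Sv b) by lra; ring.
Qed.

Lemma RInt_near_affine (g : R -> R) (a b A k e : R) : a <= b -> ex_RInt g a b ->
  (forall s, a <= s <= b -> Rabs (g s - (A + k * s)) <= e) ->
  Rabs (RInt g a b - (A * (b - a) + k * (b ^ 2 - a ^ 2) / 2)) <= e * (b - a).
Proof.
intros ab Hg Hb.
assert (I : forall A', is_RInt (fun s => A' + k * s) a b (A' * (b - a) + k * (b ^ 2 - a ^ 2) / 2)).
{ intros A'.
  replace (A' * (b - a) + k * (b ^ 2 - a ^ 2) / 2)
    with (minus (A' * b + k * b ^ 2 / 2) (A' * a + k * a ^ 2 / 2))
    by (unfold minus, plus, opp; simpl; field).
  apply (is_RInt_derive (fun s => A' * s + k * s ^ 2 / 2)).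
  - intros s _; auto_derive; [trivial|field].
  - intros s _; apply (continuous_plus (V := R_NormedModule)); [apply continuous_const|].
    apply (continuous_mult (K := R_AbsRing)); [apply continuous_const|apply continuous_id]. }
assert (L : RInt (fun s => (A - e) + k * s) a b <= RInt g a b).
{ apply RInt_le; [exact ab|eexists; apply I|exact Hg|].
  intros s Hs; specialize (Hb s (conj (Rlt_le _ _ (proj1 Hs)) (Rlt_le _ _ (proj2 Hs)))).
  apply Rabs_le_between in Hb; lra. }
assert (U : RInt g a b <= RInt (fun s => (A + e) + k * s) a b).
{ apply RInt_le; [exact ab|exact Hg|eexists; apply I|].
  intros s Hs; specialize (Hb s (conj (Rlt_le _ _ (proj1 Hs)) (Rlt_le _ _ (proj2 Hs)))).
  apply Rabs_le_between in Hb; lra. }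
rewrite (is_RInt_unique _ _ _ _ (I (A - e))) in L.
rewrite (is_RInt_unique _ _ _ _ (I (A + e))) in U.
apply Rabs_le_between; split; lra.
Qed.

(** Affine functions have zero contour integral, so only the error [e]
    contributes, over the length of the boundary. *)
Lemma contour_near_affine (H : C -> C) (B : box) (w k : C) (e : R) :
  0 < width B -> 0 < height B -> (forall z, in_box z B -> ccont H z) ->
  (forall z, in_box z B -> Cmod (H z - (w + k * z)) <= e) ->
  Rabs (contour H B) <= 2 * e * (width B + height B).
Proof.
destruct B as [a b c d]; unfold width, height, contour; simpl.
intros ab cd Hc He.
assert (Eh : forall y, c <= y <= d -> Rabs (RInt (fun s => Im (H (s, y))) a b
     - ((Im w + Re k * y) * (b - a) + Im k * (b ^ 2 - a ^ 2) / 2)) <= e * (b - a)).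
{ intros y Hy; apply RInt_near_affine; [lra| |].
  - apply ex_RInt_hline; [lra|]; intros s Hs; apply Hc; now split.
  - intros s Hs; refine (Rle_trans _ _ _ _ (He (s, y) _)); [|now split].
    refine (Rle_trans _ _ _ (Req_le _ _ _) (im_le_Cmod _)).
    f_equal; unfold Im, Re; simpl; ring. }
assert (Ev : forall x, a <= x <= b -> Rabs (RInt (fun t => Re (H (x, t))) c d
     - ((Re w + Re k * x) * (d - c) + (- Im k) * (d ^ 2 - c ^ 2) / 2)) <= e * (d - c)).
{ intros x Hx; apply RInt_near_affine; [lra| |].
  - apply ex_RInt_vline; [lra|]; intros s Hs; apply Hc; now split.
  - intros s Hs; refine (Rle_trans _ _ _ _ (He (x, s) _)); [|now split].
    refine (Rle_trans _ _ _ (Req_le _ _ _) (re_le_Cmod _)).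
    f_equal; unfold Im, Re; simpl; ring. }
assert (H1 := Eh c ltac:(lra)); assert (H2 := Eh d ltac:(lra)).
assert (H3 := Ev a ltac:(lra)); assert (H4 := Ev b ltac:(lra)).
apply Rabs_le_between in H1; apply Rabs_le_between in H2.
apply Rabs_le_between in H3; apply Rabs_le_between in H4.
apply Rabs_le_between; lra.
Qed.

(** If the integral were nonzero, some sequence of quarters would keep the ratio
    of the integral to the squared size above a positive constant; at the limit
    point differentiability makes that ratio tend to 0. *)
Lemma goursat (H : C -> C) (B : box) : 0 < width B -> 0 < height B ->
  (forall z, in_box z B -> cdiff H z) -> contour H B = 0.
Proof.
intros wB hB Hd; apply NNPP; intros nz; apply Rabs_pos_lt in nz.
set (size := fun B => width B + height B).
set (k := Rabs (contour H B) / size B ^ 2).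
assert (sB : 0 < size B) by (unfold size; lra).
assert (kpos : 0 < k) by (apply Rdiv_lt_0_compat; [exact nz|now apply pow_lt]).
assert (sub_in : forall B1 z, subbox B1 B -> in_box z B1 -> in_box z B).
{ unfold subbox, in_box; intros; lra. }
destruct (bisection (fun B' => k * size B' ^ 2 <= Rabs (contour H B')) B wB hB) as [z [Bz Hz]].
- apply Req_le; unfold k; field; lra.
- intros B' s' w' h' K.
  assert (Q := contour_quarters H B' w' h' (fun z Hz => cdiff_ccont _ _ (Hd z (sub_in _ z s' Hz)))).
  destruct B' as [a b c d]; unfold size, width, height in *; simpl in *.
  unfold xmid, ymid; simpl.
  set (x1 := contour H (quarter_sw _)) in *; set (x2 := contour H (quarter_se _)) in *.
  set (x3 := contour H (quarter_nw _)) in *; set (x4 := contour H (quarter_ne _)) in *.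
  assert (T : Rabs (x1 + x2 + x3 + x4) <= Rabs x1 + Rabs x2 + Rabs x3 + Rabs x4).
  { assert (T1 := Rabs_triang (x1 + x2 + x3) x4); assert (T2 := Rabs_triang (x1 + x2) x3).
    assert (T3 := Rabs_triang x1 x2); lra. }
  rewrite Q in K.
  destruct (Rle_dec (k * (b - a + (d - c)) ^ 2 / 4) (Rabs x1)); [left; lra|right].
  destruct (Rle_dec (k * (b - a + (d - c)) ^ 2 / 4) (Rabs x2)); [left; lra|right].
  destruct (Rle_dec (k * (b - a + (d - c)) ^ 2 / 4) (Rabs x3)); [left; lra|right].
  lra.
- destruct (Hd z Bz) as [q [Hq E]].
  destruct (proj1 (ccont_eps _ _) Hq (k / 4)) as [r [Hr Er]]; [lra|].
  destruct (Hz (r / 2)) as [B' [s' [z' [K [w' h']]]]]; [lra|].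
  assert (A : Rabs (contour H B') <= 2 * (k / 4 * size B') * size B').
  { apply (contour_near_affine H B' (H z - q z * z)%C (q z)); try lra.
    - intros y Hy; apply cdiff_ccont, Hd, (sub_in B'); assumption.
    - intros y Hy.
      assert (yz : Cmod (y - z) <= size B').
      { apply (Rle_trans _ _ _ (Cmod_le_Re_Im _)).
        unfold in_box, size, width, height, Re, Im in *; simpl.
        apply Rplus_le_compat; apply Rabs_le_between; lra. }
      rewrite (E y).
      replace (H z + q y * (y - z) - (H z - q z * z + q z * y))%C
        with ((q y - q z) * (y - z))%C by ring.
      rewrite Cmod_mult; apply Rmult_le_compat; [apply Cmod_ge_0|apply Cmod_ge_0| |exact yz].
      apply Rlt_le, Er; unfold size in yz; lra. }
  assert (0 < k * size B' ^ 2) by (apply Rmult_lt_0_compat, pow_lt; unfold size; lra).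
  nra.
Qed.

(** * The maximum principle *)

Definition cexp (w : C) : C := (RtoC (exp (Re w)) * expi (Im w))%C.

Lemma Cmod_expi (t : R) : Cmod (expi t) = 1.
Proof.
unfold Cmod, expi; simpl; rewrite !Rmult_1_r, Rplus_comm, <- sqrt_1; f_equal; apply sin2_cos2.
Qed.

Lemma Cmod_cexp (w : C) : Cmod (cexp w) = exp (Re w).
Proof.
unfold cexp; rewrite Cmod_mult, Cmod_expi, Cmod_R, Rmult_1_r.
apply Rabs_pos_eq, Rlt_le, exp_pos.
Qed.

Lemma cexp_add (z w : C) : cexp (z + w) = (cexp z * cexp w)%C.
Proof.
unfold cexp, expi, Cmult, Cplus, RtoC, Re, Im; simpl; rewrite exp_plus, cos_plus, sin_plus.
f_equal; ring.
Qed.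

Lemma first_order (g : R -> R) (l e : R) : derivable_pt_lim g 0 l -> 0 < e ->
  exists d, 0 < d /\ forall h, Rabs h < d -> Rabs (g h - g 0 - l * h) <= e * Rabs h.
Proof.
intros Hg He; destruct (Hg e He) as [d Hd].
exists d; split; [apply cond_pos|]; intros h Hh.
destruct (Req_dec h 0) as [->|n].
- replace (g 0 - g 0 - l * 0) with 0 by ring; rewrite Rabs_R0; lra.
- specialize (Hd h n Hh); rewrite Rplus_0_l in Hd.
  replace (g h - g 0 - l * h) with (((g h - g 0) / h - l) * h) by (field; exact n).
  rewrite Rabs_mult; apply Rmult_le_compat_r; [apply Rabs_pos|lra].
Qed.

Lemma cexp_first_order (e : R) : 0 < e ->
  exists d, 0 < d /\ forall w, Cmod w < d -> Cmod (cexp w - 1 - w) <= e * Cmod w.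
Proof.
intros He; set (n := Rmin 1 (e / 12)).
assert (np : 0 < n) by (apply Rmin_glb_lt; lra).
assert (n1 : n <= 1) by apply Rmin_l.
assert (ne : n <= e / 12) by apply Rmin_r.
destruct (first_order exp 1 n derivable_pt_lim_exp_0 np) as [d1 [p1 H1]].
destruct (first_order sin 1 n derivable_pt_lim_sin_0 np) as [d2 [p2 H2]].
destruct (first_order cos 0 n derivable_pt_lim_cos_0 np) as [d3 [p3 H3]].
exists (Rmin n (Rmin d1 (Rmin d2 d3))); split; [now do 3 (apply Rmin_glb_lt; [assumption|])|].
intros w Hw.
assert (M1 := Rmin_l n (Rmin d1 (Rmin d2 d3))); assert (M2 := Rmin_r n (Rmin d1 (Rmin d2 d3))).
assert (M3 := Rmin_l d1 (Rmin d2 d3)); assert (M4 := Rmin_r d1 (Rmin d2 d3)).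
assert (M5 := Rmin_l d2 d3); assert (M6 := Rmin_r d2 d3).
assert (Rw := re_le_Cmod w); assert (Iw := im_le_Cmod w).
unfold Re, Im in *; destruct w as [s t]; simpl fst in *; simpl snd in *.
specialize (H1 s ltac:(lra)); specialize (H2 t ltac:(lra)); specialize (H3 t ltac:(lra)).
rewrite exp_0 in H1; rewrite sin_0 in H2; rewrite cos_0 in H3.
assert (es : exp s <= 3).
{ apply (Rle_trans _ (exp 1)); [|exact exp_le_3].
  apply Rlt_le, exp_increasing; assert (T := Rle_abs s); lra. }
assert (ep := exp_pos s).
apply (Rle_trans _ _ _ (Cmod_le_Re_Im _)); unfold cexp, expi, Re, Im; simpl.
replace (exp s * cos t - 0 * sin t + - (1) + - s)
  with ((exp s - 1 - 1 * s) + exp s * (cos t - 1 - 0 * t)) by ring.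
replace (exp s * sin t + 0 * cos t + - 0 + - t)
  with (exp s * (sin t - 0 - 1 * t) + (exp s - 1 - 1 * s) * t + s * t) by ring.
set (E := exp s - 1 - 1 * s) in *; set (S := sin t - 0 - 1 * t) in *; set (K := cos t - 1 - 0 * t) in *.
assert (T1 := Rabs_triang E (exp s * K)).
assert (T2 := Rabs_triang (exp s * S + E * t) (s * t)).
assert (T3 := Rabs_triang (exp s * S) (E * t)).
rewrite Rabs_mult, (Rabs_pos_eq (exp s)) in T1, T3 by lra.
rewrite Rabs_mult in T2; rewrite (Rabs_mult E) in T3.
assert (as0 := Rabs_pos s); assert (at0 := Rabs_pos t).
assert (aK := Rabs_pos K); assert (aS := Rabs_pos S); assert (aE := Rabs_pos E).
set (m := Cmod (s, t)) in *.
assert (B1 : exp s * Rabs K <= 3 * (n * m)) by (apply Rmult_le_compat; nra).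
assert (B2 : exp s * Rabs S <= 3 * (n * m)) by (apply Rmult_le_compat; nra).
assert (B3 : Rabs E * Rabs t <= (n * m) * 1) by (apply Rmult_le_compat; nra).
assert (B4 : Rabs s * Rabs t <= m * n) by (apply Rmult_le_compat; nra).
assert (B5 : Rabs E <= n * m) by nra.
nra.
Qed.

Lemma cdiff_cexp (z : C) : cdiff cexp z.
Proof.
assert (D0 : cdiff cexp 0%C).
{ exists (fun w : C => if excluded_middle_informative (w = 0%C) then RtoC 1 else ((cexp w - 1) / w)%C).
  assert (c0 : cexp 0 = 1%C).
  { unfold cexp, expi; simpl; rewrite exp_0, cos_0, sin_0; apply Cmult_1_l. }
  split.
  - apply ccont_eps; intros e He.
    assert (He2 : 0 < e / 2) by lra.
    destruct (cexp_first_order (e / 2) He2) as [d [Hd H]].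
    exists d; split; [exact Hd|]; intros w Hw.
    replace (w - 0)%C with w in Hw by ring; specialize (H w Hw).
    destruct (excluded_middle_informative (RtoC 0 = RtoC 0)) as [_|n]; [|easy].
    destruct excluded_middle_informative as [->|n].
    + rewrite Cminus_diag, Cmod_0; exact He.
    + replace ((cexp w - 1) / w - 1)%C with ((cexp w - 1 - w) / w)%C by (field; exact n).
      rewrite Cmod_div by exact n; apply Cmod_gt_0 in n.
      apply Rlt_div_l; [exact n|]; nra.
  - intros w; rewrite c0; destruct excluded_middle_informative as [->|n].
    + rewrite c0; ring.
    + field; exact n. }
apply (cdiff_local (fun w => (cexp z * cexp (w - z))%C) _ _ 1 Rlt_0_1).
- intros w _; rewrite <- cexp_add; f_equal; ring.
- apply cdiff_mult; [apply cdiff_const|apply (cdiff_comp (fun w => (w - z)%C))].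
  + apply cdiff_minus; [apply cdiff_id|apply cdiff_const].
  + rewrite Cminus_diag; exact D0.
Qed.

(** With [H w = G (z0 + cexp w)], vertical segments of length [2 * PI] are circles
    around [z0] and horizontal sides cancel by periodicity. Hence [goursat] equates
    the means of [Re G] over two concentric circles: the large one has mean at
    most [Re (G z0) - e * r ^ 2], the small one has mean close to [Re (G z0)]. *)
Lemma no_quadratic_peak (G : C -> C) (z0 : C) (r e : R) : 0 < r -> 0 < e ->
  (forall z, Cmod (z - z0) <= r -> cdiff G z) ->
  (forall z, Cmod (z - z0) <= r -> Re (G z) <= Re (G z0) - e * Cmod (z - z0) ^ 2) ->
  False.
Proof.
intros Hr He Hd Hpeak.
assert (Cc : ccont G z0) by (apply cdiff_ccont, Hd; rewrite Cminus_diag, Cmod_0; lra).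
set (k := e * r ^ 2); assert (kp : 0 < k) by (apply Rmult_lt_0_compat, pow_lt; assumption).
destruct (proj1 (ccont_eps _ _) Cc (k / 2)) as [d [dp Hdk]]; [lra|].
set (r1 := Rmin d r / 2).
assert (r1p : 0 < r1) by (unfold r1; assert (0 < Rmin d r) by (now apply Rmin_glb_lt); lra).
assert (r1d : r1 < d) by (unfold r1 in *; assert (T := Rmin_l d r); lra).
assert (r1r : r1 < r) by (unfold r1 in *; assert (T := Rmin_r d r); lra).
assert (lnlt : ln r1 < ln r) by now apply ln_increasing.
assert (PIp := PI_RGT_0).
set (H := fun w => G (z0 + cexp w)%C).
set (B := Box (ln r1) (ln r) 0 (2 * PI)).
assert (rad : forall w, Cmod (z0 + cexp w - z0) = exp (Re w)).
{ intros w; rewrite <- Cmod_cexp; f_equal; ring. }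
assert (HB : forall w, in_box w B -> cdiff H w).
{ intros w [[_ Hw] _]; simpl in Hw.
  apply (cdiff_comp (fun w => (z0 + cexp w)%C)).
  - apply cdiff_plus; [apply cdiff_const|apply cdiff_cexp].
  - apply Hd; rewrite rad, <- (exp_ln r Hr).
    destruct Hw as [Hw|Hw]; [left; now apply exp_increasing|right; now rewrite Hw]. }
assert (I0 : contour H B = 0).
{ apply goursat; [unfold B, width; simpl; lra|unfold B, height; simpl; lra|exact HB]. }
unfold contour, B in I0; simpl in I0.
replace (fun s => Im (H (s, 2 * PI))) with (fun s => Im (H (s, 0))) in I0.
2:{ apply functional_extensionality; intros s; unfold H, cexp, expi; simpl.
    now rewrite cos_0, sin_0, cos_2PI, sin_2PI. }
assert (ex : forall s, ln r1 <= s <= ln r -> ex_RInt (fun t => Re (H (s, t))) 0 (2 * PI)).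
{ intros s Hs; apply ex_RInt_vline; [lra|]; intros t Ht; apply cdiff_ccont, HB; now split. }
assert (U : RInt (fun t => Re (H (ln r, t))) 0 (2 * PI) <= RInt (fun _ => Re (G z0) - k) 0 (2 * PI)).
{ apply RInt_le; [lra|apply ex; lra|apply ex_RInt_const|]; intros t _; unfold H.
  assert (Er := rad (ln r, t)); simpl in Er; rewrite exp_ln in Er by exact Hr.
  refine (Rle_trans _ _ _ (Hpeak _ _) _); rewrite Er; [lra|unfold k; lra]. }
assert (L : RInt (fun _ => Re (G z0) - k / 2) 0 (2 * PI) <= RInt (fun t => Re (H (ln r1, t))) 0 (2 * PI)).
{ apply RInt_le; [lra|apply ex_RInt_const|apply ex; lra|]; intros t _; unfold H.
  assert (Er := rad (ln r1, t)); simpl in Er; rewrite exp_ln in Er by exact r1p.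
  assert (T := re_le_Cmod (G (z0 + cexp (ln r1, t))%C - G z0)).
  specialize (Hdk (z0 + cexp (ln r1, t))%C); rewrite Er in Hdk; specialize (Hdk r1d).
  apply Rabs_le_between in T; unfold Re, Cminus, Cplus, Copp in *; simpl in *; lra. }
rewrite RInt_const in U, L; unfold scal in U, L; simpl in U, L; unfold mult in U, L; simpl in U, L.
nra.
Qed.

Definition rcont (F : C -> R) (z : C) : Prop :=
  forall e, 0 < e -> exists d, 0 < d /\ forall w, Cmod (w - z) < d -> Rabs (F w - F z) < e.

Lemma rcont_Re (f : C -> C) (z : C) : ccont f z -> rcont (fun w => Re (f w)) z.
Proof.
intros Hf e He; destruct (proj1 (ccont_eps _ _) Hf e He) as [d [dp H]].
exists d; split; [exact dp|]; intros w Hw.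
exact (Rle_lt_trans _ _ _ (re_le_Cmod (f w - f z)%C) (H w Hw)).
Qed.

Lemma rcont_Cmod2 (z : C) : rcont (fun w => Cmod w ^ 2) z.
Proof.
intros e He; set (m := Cmod z); assert (mp : 0 <= m) by apply Cmod_ge_0.
exists (Rmin 1 (e / (2 * m + 2))); split.
{ apply Rmin_glb_lt; [lra|apply Rdiv_lt_0_compat; lra]. }
intros w Hw.
assert (H1 := Rlt_le_trans _ _ _ Hw (Rmin_l _ _)); assert (H2 := Rlt_le_trans _ _ _ Hw (Rmin_r _ _)).
apply Rlt_div_r in H2; [|lra].
assert (T1 := Cmod_sub_ge w z); assert (T2 := Cmod_sub_ge z w); rewrite (Cmod_minus_sym z w) in T2.
assert (wp := Cmod_ge_0 w); fold m in T1, T2 |- *; assert (dp := Cmod_ge_0 (w - z)).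
apply Rabs_lt_between; split; nra.
Qed.

(** The bisected property of a box is that it contains points of the disc at
    which [F] is at least as large as at any prescribed point. *)
Lemma max_on_disc (F : C -> R) (r : R) : 0 < r ->
  (forall z, Cmod z <= r -> rcont F z) ->
  exists z, Cmod z <= r /\ forall w, Cmod w <= r -> F w <= F z.
Proof.
intros Hr HF.
set (P := fun B => forall w, Cmod w <= r -> exists z, in_box z B /\ Cmod z <= r /\ F w <= F z).
destruct (bisection P (Box (- r) r (- r) r)) as [z [_ Hz]].
- unfold width; simpl; lra.
- unfold height; simpl; lra.
- intros w Hw; exists w; repeat split; try lra; simpl;
    assert (T1 := re_le_Cmod w); assert (T2 := im_le_Cmod w);
    apply Rabs_le_between in T1; apply Rabs_le_between in T2; lra.
- intros B _ wB hB HP; apply NNPP; intros N.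
  apply not_or_and in N; destruct N as [N1 N]; apply not_or_and in N; destruct N as [N2 N].
  apply not_or_and in N; destruct N as [N3 N4].
  assert (step : forall B', ~ P B' -> exists w, Cmod w <= r /\
            forall z, in_box z B' -> Cmod z <= r -> F z < F w).
  { intros B' NP; apply not_all_ex_not in NP; destruct NP as [w NP].
    apply imply_to_and in NP; destruct NP as [Hw NP]; exists w; split; [exact Hw|].
    intros z zB zr; apply Rnot_le_lt; intros le; apply NP; exists z; auto. }
  destruct (step _ N1) as [w1 [r1 H1]]; destruct (step _ N2) as [w2 [r2 H2]].
  destruct (step _ N3) as [w3 [r3 H3]]; destruct (step _ N4) as [w4 [r4 H4]].
  assert (best : exists w, Cmod w <= r /\ F w1 <= F w /\ F w2 <= F w /\ F w3 <= F w /\ F w4 <= F w).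
  { assert (two : forall a b, Cmod a <= r -> Cmod b <= r ->
        exists c, Cmod c <= r /\ F a <= F c /\ F b <= F c).
    { intros a b Ha Hb; destruct (Rle_dec (F a) (F b)); [exists b|exists a]; repeat split; lra. }
    destruct (two w1 w2 r1 r2) as [a [Ha [a1 a2]]]; destruct (two w3 w4 r3 r4) as [b [Hb [b1 b2]]].
    destruct (two a b Ha Hb) as [c [Hc [c1 c2]]]; exists c; repeat split; lra. }
  destruct best as [w [Hw [b1 [b2 [b3 b4]]]]].
  destruct (HP w Hw) as [z [[zx zy] [zr le]]].
  destruct (Rle_dec (Re z) (xmid B)) as [x|x]; destruct (Rle_dec (Im z) (ymid B)) as [y|y].
  + assert (T := H1 z ltac:(repeat split; simpl; lra) zr); lra.
  + assert (T := H3 z ltac:(repeat split; simpl; lra) zr); lra.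
  + assert (T := H2 z ltac:(repeat split; simpl; lra) zr); lra.
  + assert (T := H4 z ltac:(repeat split; simpl; lra) zr); lra.
- assert (near : forall w d, Cmod w <= r -> 0 < d ->
      exists y, Cmod (y - z) < d /\ Cmod y <= r /\ F w <= F y).
  { intros w d Hw Hd; destruct (Hz (d / 2)) as [B [_ [zB [PB [wB hB]]]]]; [lra|].
    destruct (PB w Hw) as [y [yB Hy]]; exists y; split; [|exact Hy].
    apply (Rle_lt_trans _ _ _ (Cmod_le_Re_Im _)).
    assert (Rabs (Re (y - z)) <= width B /\ Rabs (Im (y - z)) <= height B).
    { unfold in_box, width, height, Re, Im in *; simpl; split; apply Rabs_le_between; lra. }
    lra. }
  assert (zr : Cmod z <= r).
  { apply Rnot_lt_le; intros lt; destruct (near 0%C (Cmod z - r)) as [y [Hy [yr _]]].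
    - rewrite Cmod_0; lra.
    - lra.
    - rewrite Cmod_minus_sym in Hy; assert (T := Cmod_sub_ge z y); lra. }
  exists z; split; [exact zr|]; intros w Hw; apply Rnot_lt_le; intros lt.
  destruct (HF z zr (F w - F z)) as [d [dp Hd]]; [lra|].
  destruct (near w d Hw dp) as [y [Hy [_ le]]]; specialize (Hd y Hy).
  apply Rabs_lt_between in Hd; lra.
Qed.

(** If the bound failed inside, [Re f + e * |z|^2] would for small [e] still have
    an interior maximum, and there a function with the derivative shifted by a
    constant has a quadratic peak. *)
Lemma max_Re (f : C -> C) (r M : R) : 0 < r ->
  (forall z, Cmod z <= r -> cdiff f z) ->
  (forall z, Cmod z = r -> Re (f z) <= M) ->
  forall z, Cmod z <= r -> Re (f z) <= M.
Proof.
intros Hr Hd Hb z1 Hz1; apply Rnot_lt_le; intros lt.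
(* so that e |z|^2 is at most half of the excess of Re f over M at z1 *)
set (e := (Re (f z1) - M) / (2 * r ^ 2)).
assert (r2 : 0 < r ^ 2) by now apply pow_lt.
assert (ep : 0 < e) by (apply Rdiv_lt_0_compat; lra).
set (F := fun z => Re (f z) + e * Cmod z ^ 2).
destruct (max_on_disc F r Hr) as [z0 [Hz0 Hmax]].
{ intros z Hz k Hk.
  destruct (rcont_Re f z (cdiff_ccont _ _ (Hd z Hz)) (k / 2)) as [d1 [p1 H1]]; [lra|].
  destruct (rcont_Cmod2 z (k / 2 / e)) as [d2 [p2 H2]]; [apply Rdiv_lt_0_compat; lra|].
  exists (Rmin d1 d2); split; [now apply Rmin_glb_lt|]; intros w Hw.
  specialize (H1 w (Rlt_le_trans _ _ _ Hw (Rmin_l _ _))).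
  specialize (H2 w (Rlt_le_trans _ _ _ Hw (Rmin_r _ _))).
  apply Rlt_div_r in H2; [|exact ep].
  unfold F; replace (Re (f w) + e * Cmod w ^ 2 - (Re (f z) + e * Cmod z ^ 2))
    with ((Re (f w) - Re (f z)) + (Cmod w ^ 2 - Cmod z ^ 2) * e) by ring.
  apply (Rle_lt_trans _ _ _ (Rabs_triang _ _)); rewrite Rabs_mult, (Rabs_pos_eq e) by lra; lra. }
assert (lt0 : Cmod z0 < r).
{ apply Rnot_le_lt; intros ge; assert (E : Cmod z0 = r) by lra.
  specialize (Hmax z1 Hz1); specialize (Hb z0 E); unfold F in Hmax; rewrite E in Hmax.
  assert (e * r ^ 2 = (Re (f z1) - M) / 2) by (unfold e; field; lra).
  assert (0 <= e * Cmod z1 ^ 2) by (apply Rmult_le_pos; [lra|apply pow2_ge_0]).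
  lra. }
(* |z|^2 = |z0|^2 + 2 Re (Cconj z0 (z - z0)) + |z - z0|^2 : the middle term is
   the real part of a holomorphic function, the last one makes the peak. *)
apply (no_quadratic_peak (fun z => f z + RtoC (2 * e) * Cconj z0 * (z - z0))%C z0 (r - Cmod z0) e);
  [lra|exact ep| |].
- intros z Hz; apply cdiff_plus.
  + apply Hd; assert (T := Cmod_sub_ge z z0); lra.
  + apply cdiff_mult; [apply cdiff_const|apply cdiff_minus; [apply cdiff_id|apply cdiff_const]].
- intros z Hz; specialize (Hmax z ltac:(assert (T := Cmod_sub_ge z z0); lra)); unfold F in Hmax.
  rewrite !Cmod2_alt in *; destruct z as [x y], z0 as [x0 y0].
  unfold Re, Im, Cconj, RtoC in *; simpl in *; nra.
Qed.

(** Rotate [f] so that its value at the given point is its modulus. *)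
Lemma max_modulus_cdiff (f : C -> C) (r M : R) : 0 < r ->
  (forall z, Cmod z <= r -> cdiff f z) ->
  (forall z, Cmod z = r -> Cmod (f z) <= M) ->
  forall z, Cmod z <= r -> Cmod (f z) <= M.
Proof.
intros Hr Hd Hb z1 Hz1.
destruct (Req_dec (Cmod (f z1)) 0) as [E|n].
{ rewrite E; refine (Rle_trans _ _ _ (Cmod_ge_0 _) (Hb (RtoC r) _)).
  rewrite Cmod_R; apply Rabs_pos_eq; lra. }
assert (p : 0 < Cmod (f z1)) by (assert (T := Cmod_ge_0 (f z1)); lra).
set (u := (Cconj (f z1) / RtoC (Cmod (f z1)))%C).
assert (Hu : Cmod u = 1).
{ unfold u; rewrite Cmod_div, Cmod_conj, Cmod_R, Rabs_pos_eq by (try lra; intros E; apply n, RtoC_inj, E).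
  now apply Rinv_r. }
assert (E : Re (u * f z1) = Cmod (f z1)).
{ replace (u * f z1)%C with (RtoC (Cmod (f z1))); [reflexivity|].
  unfold u; replace (Cconj (f z1) / RtoC (Cmod (f z1)) * f z1)%C
    with (f z1 * Cconj (f z1) / RtoC (Cmod (f z1)))%C by (field; intros E; apply n, RtoC_inj, E).
  rewrite <- Cmod2_conj, RtoC_pow.
  field; intros E; apply n, RtoC_inj, E. }
rewrite <- E; apply (max_Re (fun z => u * f z)%C r M Hr); [| |exact Hz1].
- intros z Hz; apply cdiff_mult; [apply cdiff_const|now apply Hd].
- intros z Hz; apply (Rle_trans _ _ _ (Rle_abs _)), (Rle_trans _ _ _ (re_le_Cmod _)).
  rewrite Cmod_mult, Hu, Rmult_1_l; now apply Hb.
Qed.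

(** * Exceptional points and removable singularities *)

Fixpoint vanish_at (L : list C) (z : C) : C :=
  match L with [] => RtoC 1 | a :: L => ((z - a) * vanish_at L z)%C end.

Lemma ccont_vanish_at (L : list C) (z : C) : ccont (vanish_at L) z.
Proof.
induction L as [|a L IH]; [exact (ccont_const 1 z)|].
apply (ccont_mult (fun w => (w - a)%C)); [|exact IH].
apply ccont_minus; [apply ccont_id|apply ccont_const].
Qed.

Lemma vanish_at_neq0 (L : list C) (z : C) : ~ In z L -> vanish_at L z <> 0%C.
Proof.
induction L as [|a L IH]; intros n.
- exact C1_nz.
- apply Cmult_neq_0; [apply Cminus_neq0; intros ->; apply n; now left|].
  apply IH; intros i; apply n; now right.
Qed.

Lemma vanish_at_bound (L : list C) (r : R) :
  exists K, 0 < K /\ forall z, Cmod z <= r -> Cmod (vanish_at L z) <= K.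
Proof.
induction L as [|a L [K [Kp HK]]].
- exists 1; split; [lra|]; intros z _; simpl; rewrite Cmod_1; lra.
- exists ((Rabs r + Cmod a + 1) * K); split.
  + apply Rmult_lt_0_compat; [|exact Kp].
    assert (T1 := Rabs_pos r); assert (T2 := Cmod_ge_0 a); lra.
  + intros z Hz; simpl; rewrite Cmod_mult; apply Rmult_le_compat; auto using Cmod_ge_0.
    assert (T1 := Rle_abs r); assert (T2 := Cmod_sub_le z a); lra.
Qed.

(** The factor [z - a] times a continuous function is differentiable at [a]. *)
Lemma cdiff_vanish_at (L : list C) (f : C -> C) (z : C) :
  ccont f z -> (~ In z L -> cdiff f z) -> cdiff (fun w => (vanish_at L w * f w)%C) z.
Proof.
intros Hc; induction L as [|a L IH]; intros Hd.
- apply cdiff_mult; [apply cdiff_const|apply Hd; intros []].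
- apply (cdiff_local (fun w => ((w - a) * (vanish_at L w * f w))%C) _ _ 1 Rlt_0_1).
  { intros w _; simpl; ring. }
  destruct (classic (z = a)) as [->|n].
  + exists (fun w => (vanish_at L w * f w)%C); split; [|intros w; rewrite Cminus_diag; ring].
    apply ccont_mult; [apply ccont_vanish_at|exact Hc].
  + apply cdiff_mult; [apply cdiff_minus; [apply cdiff_id|apply cdiff_const]|].
    apply IH; intros i; apply Hd; intros [->|i']; [now apply n|now apply i].
Qed.

Lemma pow_unbounded (x K : R) : 1 < x -> exists n, K < x ^ n.
Proof.
intros Hx; destruct (Pow_x_infinity x) with (b := K + 1) as [n Hn].
- rewrite Rabs_pos_eq; lra.
- exists n; specialize (Hn n (le_n n)); rewrite Rabs_pos_eq in Hn; [lra|apply pow_le; lra].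
Qed.

Lemma avoid_list (L : list C) (z : C) (d : R) : 0 < d ->
  exists d', 0 < d' <= d /\ forall w, 0 < Cmod (w - z) < d' -> ~ In w L.
Proof.
intros Hd; induction L as [|a L [d' [Hd' H]]].
- exists d; split; [lra|intros w _ []].
- destruct (classic (a = z)) as [->|n].
  + exists d'; split; [exact Hd'|]; intros w Hw [->|i]; [|now apply (H w)].
    rewrite Cminus_diag, Cmod_0 in Hw; lra.
  + apply Cmod_sub_gt0 in n; exists (Rmin d' (Cmod (a - z))); split.
    { split; [apply Rmin_glb_lt; lra|apply (Rle_trans _ _ _ (Rmin_l _ _)); lra]. }
    intros w [w0 Hw] [->|i].
    * assert (T := Rmin_r d' (Cmod (w - z))); lra.
    * apply (H w); [|exact i]; assert (T := Rmin_l d' (Cmod (a - z))); lra.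
Qed.

(** Multiplying by [vanish_at L] removes the exceptional points but spoils the
    bound by a constant [K]. Doing this with [f ^ n] only spoils it by the n-th root
    of a constant, which tends to 1. *)
Lemma max_modulus (L : list C) (f : C -> C) (r M : R) : 0 < r ->
  (forall z, Cmod z <= r -> ccont f z) ->
  (forall z, Cmod z <= r -> ~ In z L -> cdiff f z) ->
  (forall z, Cmod z = r -> Cmod (f z) <= M) ->
  forall z, Cmod z < r -> Cmod (f z) <= M.
Proof.
intros Hr Hc Hd Hb.
assert (Mp : 0 <= M).
{ refine (Rle_trans _ _ _ (Cmod_ge_0 _) (Hb (RtoC r) _)); rewrite Cmod_R; apply Rabs_pos_eq; lra. }
assert (main : forall z, Cmod z <= r -> ~ In z L -> Cmod (f z) <= M).
{ intros z Hz nL; apply Rnot_lt_le; intros lt.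
  destruct (vanish_at_bound L r) as [K [Kp HK]].
  assert (vp := proj1 (Cmod_gt_0 _) (vanish_at_neq0 L z nL)).
  (* m lies strictly between M and |f z|, so it is positive even if M = 0 *)
  set (v := Cmod (vanish_at L z)) in *; set (m := (M + Cmod (f z)) / 2).
  assert (Bn : forall n, v * Cmod (f z) ^ n <= K * m ^ n).
  { intros n; unfold v; rewrite <- Cmod_pow, <- Cmod_mult.
    apply (max_modulus_cdiff (fun w => (vanish_at L w * f w ^ n)%C) r); [exact Hr| | |exact Hz].
    - intros w Hw; apply (cdiff_vanish_at L (fun w => (f w ^ n)%C)).
      + now apply ccont_pow, Hc.
      + intros nw; apply cdiff_pow; now apply Hd.
    - intros w Hw; rewrite Cmod_mult, Cmod_pow; apply Rmult_le_compat.
      + apply Cmod_ge_0.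
      + apply pow_le, Cmod_ge_0.
      + apply HK; lra.
      + apply pow_incr; split; [apply Cmod_ge_0|]; specialize (Hb w Hw); unfold m; lra. }
  assert (mp : 0 < m) by (unfold m; lra).
  destruct (pow_unbounded (Cmod (f z) / m) (K / v)) as [n Hn].
  { apply Rlt_div_r; unfold m; lra. }
  specialize (Bn n); unfold Rdiv in Hn; rewrite Rpow_mult_distr, pow_inv in Hn.
  assert (mn : 0 < m ^ n) by now apply pow_lt.
  apply (Rmult_lt_compat_r (v * m ^ n)) in Hn; [|now apply Rmult_lt_0_compat].
  replace (K * / v * (v * m ^ n)) with (K * m ^ n) in Hn by (field; lra).
  replace (Cmod (f z) ^ n * / m ^ n * (v * m ^ n)) with (v * Cmod (f z) ^ n) in Hn by (field; lra).
  lra. }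
(* an exceptional z is a limit of points outside L *)
intros z Hz; apply Rnot_lt_le; intros lt.
destruct (proj1 (ccont_eps _ _) (Hc z (Rlt_le _ _ Hz)) (Cmod (f z) - M)) as [d [dp Hdd]]; [lra|].
destruct (avoid_list L z (Rmin d (r - Cmod z))) as [d' [[d'p d'l] Hd']]; [apply Rmin_glb_lt; lra|].
assert (T1 := Rmin_l d (r - Cmod z)); assert (T2 := Rmin_r d (r - Cmod z)).
set (w := (z + RtoC (d' / 2))%C).
assert (wz : Cmod (w - z) = d' / 2).
{ unfold w; replace (z + RtoC (d' / 2) - z)%C with (RtoC (d' / 2)) by ring.
  rewrite Cmod_R; apply Rabs_pos_eq; lra. }
assert (wr : Cmod w <= r) by (assert (T := Cmod_sub_ge w z); lra).
assert (fw := main w wr (Hd' w ltac:(lra))); specialize (Hdd w ltac:(lra)).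
rewrite Cmod_minus_sym in Hdd; assert (T := Cmod_sub_ge (f z) (f w)); lra.
Qed.

Lemma lipschitz_limit (k : C -> C) (r K : R) : 0 < r -> 0 < K ->
  (forall w v, 0 < Cmod w < r -> 0 < Cmod v < r -> Cmod (k w - k v) <= K * Cmod (w - v)) ->
  exists l, forall w, 0 < Cmod w < r -> Cmod (k w - l) <= K * Cmod w.
Proof.
intros Hr HK HL.
set (h := fun n : nat => r / (INR n + 2)).
assert (hp : forall n, 0 < h n < r).
{ intros n; assert (T := pos_INR n); split; [apply Rdiv_lt_0_compat; lra|].
  apply Rlt_div_l; nra. }
assert (hC : forall n, 0 < Cmod (RtoC (h n)) < r).
{ intros n; rewrite Cmod_R, Rabs_pos_eq; [apply hp|apply Rlt_le, hp]. }
assert (hlim : forall e, 0 < e -> exists N, forall n, (N <= n)%nat -> h n < e).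
{ intros e He; destruct (nfloor_ex (r / e)) as [N HN]; [apply Rlt_le, Rdiv_lt_0_compat; assumption|].
  exists N; intros n Hn; apply le_INR in Hn; assert (T := pos_INR n).
  apply Rlt_div_l; [lra|]; destruct HN as [_ HN]; apply Rlt_div_l in HN; [nra|exact He]. }
assert (Cau : forall p : C -> R, (forall z w, Rabs (p z - p w) <= Cmod (z - w)) ->
    exists l, is_lim_seq (fun n => p (k (RtoC (h n)))) (Finite l)).
{ intros p Hp; apply ex_lim_seq_cauchy_corr; intros e.
  destruct (hlim (e / K)) as [N HN]; [apply Rdiv_lt_0_compat; [apply cond_pos|exact HK]|].
  exists N; intros n m Hn Hm.
  apply (Rle_lt_trans _ _ _ (Hp _ _)), (Rle_lt_trans _ _ _ (HL _ _ (hC n) (hC m))).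
  rewrite <- RtoC_minus, Cmod_R.
  assert (Hn' := HN n Hn); assert (Hm' := HN m Hm).
  assert (pn := hp n); assert (pm := hp m).
  rewrite Rmult_comm; apply Rlt_div_r; [exact HK|].
  apply Rabs_lt_between; lra. }
destruct (Cau Re) as [a Ha]; [intros z w; apply (re_le_Cmod (z - w)%C)|].
destruct (Cau Im) as [b Hb]; [intros z w; apply (im_le_Cmod (z - w)%C)|].
exists (a, b); intros w Hw; apply Rnot_lt_le; intros lt.
set (e := (Cmod (k w - (a, b)) - K * Cmod w) / 4); assert (ep : 0 < e) by (unfold e; lra).
apply is_lim_seq_spec in Ha; apply is_lim_seq_spec in Hb.
destruct (Ha (mkposreal e ep)) as [N1 H1]; destruct (Hb (mkposreal e ep)) as [N2 H2].
destruct (hlim (e / K)) as [N3 H3]; [now apply Rdiv_lt_0_compat|].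
set (n := (N1 + N2 + N3)%nat).
specialize (H1 n ltac:(unfold n; lia)); specialize (H2 n ltac:(unfold n; lia)).
specialize (H3 n ltac:(unfold n; lia)); simpl in H1, H2.
apply Rlt_div_r in H3; [|exact HK].
assert (T1 := HL w _ Hw (hC n)).
assert (T2 := Cmod_sub_le w (RtoC (h n))); rewrite Cmod_R, Rabs_pos_eq in T2 by (apply Rlt_le, hp).
assert (T3 := Cmod_le_Re_Im (k (RtoC (h n)) - (a, b))%C).
assert (T4 := Cmod_triangle (k w - k (RtoC (h n))) (k (RtoC (h n)) - (a, b))%C).
replace (k w - k (RtoC (h n)) + (k (RtoC (h n)) - (a, b)))%C with (k w - (a, b))%C in T4 by ring.
unfold Re, Im in *; simpl in T3; unfold Rminus in H1, H2.
assert (K * Cmod (w - RtoC (h n)) <= K * (Cmod w + h n)) by (apply Rmult_le_compat_l; lra).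
unfold e in *; lra.
Qed.

(** The difference quotients [D w] of [g] based at points [w] near 0 are bounded by
    the maximum principle, and so are the difference quotients of [w |-> D w z];
    both bounds hold on the circle and pass to the interior through the exceptional
    points. At [z = 0] the second one says that [D w 0 = (g w - g 0) / (w - 0)] is
    Lipschitz in [w], so it converges as [w] tends to 0. *)
Lemma removable_singularity (g : C -> C) (r M : R) : 0 < r ->
  ccont g 0 -> (forall z : C, z <> 0%C -> Cmod z <= r -> cdiff g z) ->
  (forall z, Cmod z <= r -> Cmod (g z) <= M) ->
  cdiff g 0.
Proof.
intros Hr Hc Hd HM.
assert (Mp : 0 <= M) by (refine (Rle_trans _ _ _ (Cmod_ge_0 _) (HM 0%C _)); rewrite Cmod_0; lra).
assert (slope : forall w, exists D, 0 < Cmod w < r / 2 ->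
   (forall z, g z = (g w + D z * (z - w))%C) /\
   (forall z, Cmod z <= r -> ccont D z) /\
   (forall z, Cmod z <= r -> z <> 0%C -> z <> w -> cdiff D z)).
{ intros w; destruct (classic (0 < Cmod w < r / 2)) as [Hw|n]; [|exists (fun _ => RtoC 0); tauto].
  assert (w0 : w <> 0%C) by (apply Cmod_gt_0; lra).
  destruct (Hd w w0 ltac:(lra)) as [D [HD E]]; exists D; intros _; split; [exact E|split].
  - intros z Hz; destruct (classic (z = w)) as [->|n]; [exact HD|].
    apply (ccont_slope g D w); auto.
    destruct (classic (z = 0%C)) as [->|n0]; [exact Hc|now apply cdiff_ccont, Hd].
  - intros z Hz n0 n; apply (cdiff_slope g D w); auto. }
set (D := fun w => proj1_sig (constructive_indefinite_description _ (slope w))).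
assert (DP : forall w, 0 < Cmod w < r / 2 ->
   (forall z, g z = (g w + D w z * (z - w))%C) /\
   (forall z, Cmod z <= r -> ccont (D w) z) /\
   (forall z, Cmod z <= r -> z <> 0%C -> z <> w -> cdiff (D w) z)).
{ intros w; unfold D; destruct constructive_indefinite_description as [d Hd']; exact Hd'. }
clearbody D; clear slope.
(* On the circle |z| = r the quotient is at most 2 M / (r / 2); the 1 keeps K1
   positive when M = 0. *)
set (K1 := 4 * M / r + 1).
assert (K1p : 0 < K1).
{ unfold K1; assert (0 <= 4 * M / r) by (apply Rdiv_le_0_compat; lra); lra. }
assert (far : forall w z, Cmod w < r / 2 -> Cmod z = r -> r / 2 <= Cmod (z - w)).
{ intros w z Hw Hz; assert (T := Cmod_sub_ge z w); lra. }
assert (bound1 : forall w z, 0 < Cmod w < r / 2 -> Cmod z <= r -> Cmod (D w z) <= K1).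
{ intros w z Hw Hz.
  destruct (DP w Hw) as [E [Dc Dd]].
  assert (onb : forall z, Cmod z = r -> Cmod (D w z) <= K1).
  { clear z Hz; intros z Hz; assert (F := far w z (proj2 Hw) Hz).
    assert (T := Cmod_sub_le (g z) (g w)).
    replace (g z - g w)%C with (D w z * (z - w))%C in T by (rewrite (E z); ring).
    rewrite Cmod_mult in T.
    assert (gz := HM z ltac:(lra)); assert (gw := HM w ltac:(lra)).
    assert (Cmod (D w z) * (r / 2) <= K1 * (r / 2)).
    { apply (Rle_trans _ (2 * M)).
      - apply (Rle_trans _ (Cmod (D w z) * Cmod (z - w))); [|lra].
        apply Rmult_le_compat_l; [apply Cmod_ge_0|exact F].
      - unfold K1; replace ((4 * M / r + 1) * (r / 2)) with (2 * M + r / 2) by (field; lra); lra. }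
    nra. }
  destruct (Rle_lt_or_eq_dec _ _ Hz) as [lt|eq]; [|now apply onb].
  apply (max_modulus [RtoC 0; w] (D w) r); auto.
  intros y Hy n; apply Dd; [exact Hy| |]; intros ->; apply n; simpl; auto. }
set (K2 := 4 * K1 / r).
assert (K2p : 0 < K2) by (apply Rdiv_lt_0_compat; lra).
assert (bound2 : forall w v, 0 < Cmod w < r / 2 -> 0 < Cmod v < r / 2 ->
    Cmod (D w 0%C - D v 0%C) <= K2 * Cmod (w - v)).
{ intros w v Hw Hv.
  destruct (DP w Hw) as [Ew [Dcw Ddw]]; destruct (DP v Hv) as [Ev [Dcv Ddv]].
  apply (max_modulus [RtoC 0; w; v] (fun z => D w z - D v z)%C r); [exact Hr| | | |rewrite Cmod_0; exact Hr].
  - intros z Hz; apply ccont_minus; auto.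
  - intros z Hz n; apply cdiff_minus; [apply Ddw|apply Ddv]; try exact Hz; intros ->; apply n; simpl; auto.
  - intros z Hz; assert (F := far v z (proj2 Hv) Hz).
    (* second divided differences are symmetric in their arguments *)
    assert (S : ((D w z - D v z) * (z - v) = (D w z - D w v) * (w - v))%C).
    { assert (E1 := Ew z); assert (E2 := Ev z); assert (E3 := Ew v); rewrite E3, E1 in E2.
      transitivity (D w z * (z - w) - D v z * (z - v) + D w z * (w - v))%C; [ring|].
      replace (D v z * (z - v))%C with (D w z * (z - w) - D w v * (v - w))%C; [ring|].
      replace (D v z * (z - v))%C with (g w + D w v * (v - w) + D v z * (z - v) - (g w + D w v * (v - w)))%C by ring.
      rewrite <- E2; ring. }
    assert (b1 := bound1 w z Hw ltac:(lra)); assert (b2 := bound1 w v Hw ltac:(lra)).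
    assert (T := Cmod_sub_le (D w z) (D w v)).
    assert (N : Cmod (D w z - D v z) * Cmod (z - v) = Cmod (D w z - D w v) * Cmod (w - v))
      by (rewrite <- !Cmod_mult; now f_equal).
    assert (P1 := Cmod_ge_0 (D w z - D v z)); assert (P2 := Cmod_ge_0 (w - v)).
    assert (Cmod (D w z - D v z) * (r / 2) <= (K2 * Cmod (w - v)) * (r / 2)).
    { apply (Rle_trans _ (Cmod (D w z - D v z) * Cmod (z - v))); [nra|].
      rewrite N; replace (K2 * Cmod (w - v) * (r / 2)) with (2 * K1 * Cmod (w - v)) by (unfold K2; field; lra).
      nra. }
    nra. }
destruct (lipschitz_limit (fun w => D w 0%C) (r / 2) K2) as [l Hl]; [lra|exact K2p|exact bound2|].
exists (fun w : C => if excluded_middle_informative (w = 0%C) then l else ((g w - g 0) / (w - 0))%C); split.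
- apply ccont_eps; intros e He.
  exists (Rmin (r / 2) (e / K2)); split; [apply Rmin_glb_lt; [lra|now apply Rdiv_lt_0_compat]|].
  intros w Hw; replace (w - 0)%C with w in Hw by ring.
  assert (H1 := Rlt_le_trans _ _ _ Hw (Rmin_l _ _)); assert (H2 := Rlt_le_trans _ _ _ Hw (Rmin_r _ _)).
  apply Rlt_div_r in H2; [|exact K2p].
  destruct (excluded_middle_informative (RtoC 0 = RtoC 0)) as [_|n]; [|easy].
  destruct excluded_middle_informative as [->|n]; [rewrite Cminus_diag, Cmod_0; exact He|].
  assert (wp := proj1 (Cmod_gt_0 w) n).
  replace ((g w - g 0) / (w - 0))%C with (D w 0%C).
  + apply (Rle_lt_trans _ _ _ (Hl w (conj wp H1))); lra.
  + destruct (DP w (conj wp H1)) as [E _]; rewrite (E 0%C); field.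
    replace (w - 0)%C with w by ring; exact n.
- intros w; destruct excluded_middle_informative as [->|n]; [ring|].
  field; replace (w - 0)%C with w by ring; exact n.
Qed.

(** * The Schwarz lemma and the parametrisation of the class *)

Lemma Re_div (a b : C) : b <> 0%C -> Re (a / b) = Re (a * Cconj b) / Cmod b ^ 2.
Proof.
intros n.
assert (m : 0 < Re b ^ 2 + Im b ^ 2) by (rewrite <- Cmod2_alt; now apply pow_lt, Cmod_gt_0).
rewrite Cmod2_alt; destruct a as [a1 a2], b as [b1 b2]; unfold Re, Im, Cdiv, Cmult, Cinv, Cconj in *; simpl in *.
field; simpl; lra.
Qed.

Lemma one_minus_neq0 (z : C) : Cmod z < 1 -> (1 - z)%C <> 0%C.
Proof. intros Hz; apply Cminus_neq0; intros <-; rewrite Cmod_1 in Hz; lra. Qed.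

Lemma expi_conj (t : R) : (expi t * Cconj (expi t))%C = 1%C.
Proof. rewrite <- Cmod2_conj, Cmod_expi; now rewrite pow1. Qed.

Lemma expi_m2 (t : R) : expi (-2 * t) = (Cconj (expi t) * Cconj (expi t))%C.
Proof.
replace (-2 * t) with (- (2 * t)) by ring.
unfold expi, Cconj, Cmult; simpl; rewrite cos_neg, sin_neg, cos_2a, sin_2a; f_equal; ring.
Qed.

(** The real part is [cos lam] times the Poisson kernel at 1. *)
Lemma Re_p_lambda (lam : R) (z : C) : Cmod z < 1 ->
  Re (expi lam * p_lambda lam z) = cos lam * ((1 - Cmod z ^ 2) / Cmod (1 - z) ^ 2).
Proof.
intros Hz; assert (n := one_minus_neq0 z Hz).
unfold p_lambda; rewrite expi_m2.
replace (expi lam * ((1 + Cconj (expi lam) * Cconj (expi lam) * z) / (1 - z)))%C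
  with ((expi lam + (expi lam * Cconj (expi lam)) * Cconj (expi lam) * z) / (1 - z))%C by (field; exact n).
rewrite expi_conj, Re_div by exact n.
unfold Rdiv; rewrite <- Rmult_assoc; f_equal.
rewrite Cmod2_alt; destruct z as [x y]; unfold expi, Re, Im, Cconj, Cmult; simpl; ring.
Qed.

Lemma poisson_kernel_gt0 (z : C) : Cmod z < 1 -> 0 < (1 - Cmod z ^ 2) / Cmod (1 - z) ^ 2.
Proof.
intros Hz; apply Rdiv_lt_0_compat.
- assert (T := Cmod_ge_0 z); nra.
- now apply pow_lt, Cmod_gt_0, one_minus_neq0.
Qed.

Lemma P_lambda_intro (lam : R) (F : C -> C) :
  (forall z, Cmod z < 1 -> cdiff F z) -> F 0%C = 1%C ->
  (forall z, Cmod z < 1 -> 0 < Re (expi lam * F z)) ->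
  P_lambda lam (fun z : unit_disc => F z).
Proof.
intros Hd H0 Hre; split; [split|].
- exists F; split; [reflexivity|]; intros [z Hz]; apply cdiff_ex_derive, Hd, Hz.
- exact H0.
- intros [z Hz]; exact (Hre z Hz).
Qed.

Lemma p_lambda_0 (lam : R) : p_lambda lam 0 = 1%C.
Proof. unfold p_lambda; field; apply one_minus_neq0; rewrite Cmod_0; lra. Qed.

Lemma cdiff_p_lambda (lam : R) (z : C) : Cmod z < 1 -> cdiff (p_lambda lam) z.
Proof.
intros Hz; apply cdiff_div; [| |now apply one_minus_neq0].
- apply cdiff_plus; [apply cdiff_const|apply cdiff_mult; [apply cdiff_const|apply cdiff_id]].
- apply cdiff_minus; [apply cdiff_const|apply cdiff_id].
Qed.

Lemma P_lambda_subordinate (lam : R) (w : C -> C) : 0 < cos lam ->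
  (forall z, Cmod z < 1 -> cdiff w z) -> w 0%C = 0%C -> (forall z, Cmod z < 1 -> Cmod (w z) < 1) ->
  P_lambda lam (fun z : unit_disc => p_lambda lam (w z)).
Proof.
intros Hc Hd H0 Hb; apply (P_lambda_intro lam (fun z => p_lambda lam (w z))).
- intros z Hz; apply (cdiff_comp w); [now apply Hd|now apply cdiff_p_lambda, Hb].
- rewrite H0; apply p_lambda_0.
- intros z Hz; rewrite Re_p_lambda by now apply Hb.
  now apply Rmult_lt_0_compat, poisson_kernel_gt0, Hb.
Qed.

(** The difference quotient of [f] at 0 is bounded by [1 / r] on the circle of
    radius [r < 1], and [r] tends to 1. *)
Lemma schwarz (f : C -> C) : f 0%C = 0%C ->
  (forall z, Cmod z < 1 -> cdiff f z) -> (forall z, Cmod z < 1 -> Cmod (f z) <= 1) ->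
  exists w, (forall z, f z = (z * w z)%C) /\
    (forall z, Cmod z < 1 -> cdiff w z) /\ (forall z, Cmod z < 1 -> Cmod (w z) <= 1).
Proof.
intros f0 Hd Hb; destruct (Hd 0%C) as [w [Hw E]]; [rewrite Cmod_0; lra|].
assert (E' : forall z, f z = (z * w z)%C) by (intros z; rewrite (E z), f0; ring).
assert (Hwd : forall z : C, z <> 0%C -> Cmod z < 1 -> cdiff w z).
{ intros z n Hz; apply (cdiff_slope f w 0%C); auto. }
assert (Hwc : forall z : C, Cmod z < 1 -> ccont w z).
{ intros z Hz; destruct (classic (z = 0%C)) as [->|n]; [exact Hw|now apply cdiff_ccont, Hwd]. }
assert (Hwb : forall z, Cmod z < 1 -> Cmod (w z) <= 1).
{ intros z Hz; apply Rnot_lt_le; intros lt; assert (zp := Cmod_ge_0 z).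
  assert (i1 : / Cmod (w z) < 1) by (rewrite <- Rinv_1; apply Rinv_lt_contravar; lra).
  assert (i0 : 0 < / Cmod (w z)) by (apply Rinv_0_lt_compat; lra).
  assert (ii : / Cmod (w z) * Cmod (w z) = 1) by (apply Rinv_l; lra).
  assert (Hr : exists r, Cmod z < r < 1 /\ / Cmod (w z) < r).
  { assert (m := Rmax_lub_lt _ _ _ Hz i1); assert (m1 := Rmax_l (Cmod z) (/ Cmod (w z))).
    assert (m2 := Rmax_r (Cmod z) (/ Cmod (w z))).
    exists ((Rmax (Cmod z) (/ Cmod (w z)) + 1) / 2); lra. }
  destruct Hr as [r [[r1 r2] r3]].
  assert (B : Cmod (w z) <= / r).
  { apply (max_modulus [RtoC 0] w r); [lra| | | |exact r1].
    - intros y Hy; apply Hwc; lra.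
    - intros y Hy n; apply Hwd; [intros ->; apply n; simpl; auto|lra].
    - intros y Hy; assert (T := Hb y ltac:(lra)); rewrite E', Cmod_mult, Hy in T.
      apply (Rmult_le_reg_l r); [lra|]; rewrite Rinv_r; lra. }
  apply (Rmult_le_compat_l r) in B; [|lra]; rewrite Rinv_r in B by lra; nra. }
exists w; split; [exact E'|split; [|exact Hwb]].
intros z Hz; destruct (classic (z = 0%C)) as [->|n]; [|now apply Hwd].
apply (removable_singularity w (1 / 2) 1); [lra|exact Hw| |].
- intros y n Hy; apply Hwd; [exact n|lra].
- intros y Hy; apply Hwb; lra.
Qed.

Lemma P_lambda_schur (lam : R) (f : unit_disc -> C) : 0 < cos lam -> P_lambda lam f ->
  exists w, (forall z, Cmod z < 1 -> cdiff w z) /\ (forall z, Cmod z < 1 -> Cmod (w z) <= 1) /\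
    forall z : unit_disc, f z = p_lambda lam (z * w z)%C.
Proof.
intros Hc [[[F [EF dF]] f0] Hre].
assert (F0 : F 0%C = 1%C) by (rewrite <- f0, <- EF; reflexivity).
assert (FP : forall z, Cmod z < 1 -> 0 < Re (expi lam * F z)).
{ intros z Hz; assert (T := Hre (exist _ z Hz)); rewrite <- EF in T; exact T. }
assert (dF' : forall z, Cmod z < 1 -> cdiff F z).
{ intros z Hz; exact (proj2 (cdiff_ex_derive F z) (dF (exist _ z Hz))). }
assert (lt : forall z, Cmod z < 1 -> Cmod (F z - 1) < Cmod (F z + expi (-2 * lam))).
{ intros z Hz; apply FP in Hz; revert Hz; generalize (F z); intros p Hp.
  apply Rsqr_incrst_0; [|apply Cmod_ge_0|apply Cmod_ge_0].
  rewrite !Rsqr_pow2, !Cmod2_alt, expi_m2.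
  assert (P1 := Rmult_lt_0_compat _ _ Hc Hp); assert (P2 := sin2_cos2 lam).
  destruct p as [a b]; unfold expi, Re, Im, Cconj, Cmult, Cminus, Cplus, Copp, RtoC, Rsqr in *; simpl in *.
  set (c := cos lam) in *; set (s := sin lam) in *.
  replace ((b + (c * - s + - s * c)) * ((b + (c * - s + - s * c)) * 1))
    with (b ^ 2 - 4 * b * c * s + 4 * c * c * (s * s)) by ring.
  replace (s * s) with (1 - c * c) by lra.
  replace (- s * - s) with (1 - c * c) by lra.
  nra. }
assert (den : forall z, Cmod z < 1 -> (F z + expi (-2 * lam))%C <> 0%C).
{ intros z Hz; apply Cmod_gt_0; assert (T1 := lt z Hz); assert (T2 := Cmod_ge_0 (F z - 1)); lra. }
destruct (schwarz (fun z => (F z - 1) / (F z + expi (-2 * lam)))%C) as [w [Ew [dw bw]]].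
- rewrite F0; replace (1 - 1)%C with (RtoC 0) by ring; apply Cmult_0_l.
- intros z Hz; apply cdiff_div; [| |now apply den].
  + apply cdiff_minus; [now apply dF'|apply cdiff_const].
  + apply cdiff_plus; [now apply dF'|apply cdiff_const].
- intros z Hz; rewrite Cmod_div by now apply den.
  apply Rle_div_l; [apply Cmod_gt_0, den, Hz|]; rewrite Rmult_1_l; apply Rlt_le, lt, Hz.
- exists w; split; [exact dw|split; [exact bw|]].
  intros [z Hz]; rewrite <- EF; change (unit_disc_val (exist _ z Hz)) with z.
  rewrite <- (Ew z).
  assert (n1 := den z Hz); unfold p_lambda.
  assert (n2 : (1 + expi (-2 * lam))%C <> 0%C).
  { intros E0; assert (T := lt z Hz).
    replace (F z + expi (-2 * lam))%C with (F z - 1 + (1 + expi (-2 * lam)))%C in T by ring.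
    rewrite E0, Cplus_0_r in T; lra. }
  field; split; [exact n1|].
  replace (F z + expi (-2 * lam) - (F z - 1))%C with (1 + expi (-2 * lam))%C by ring; exact n2.
Qed.

(** * Extreme points *)

(** The Moebius transformation inverse to [p_lambda lam], written without
    division. *)
Lemma p_lambda_eqn (lam : R) (z : C) : Cmod z < 1 ->
  (p_lambda lam z - 1)%C = (z * (p_lambda lam z + expi (-2 * lam)))%C.
Proof. intros Hz; unfold p_lambda; field; now apply one_minus_neq0. Qed.

(** The function [N P = |P - 1|^2 - |z|^2 |P + e^(-2)|^2] of the value [P] is
    strictly convex, its quadratic part being [(1 - |z|^2) |P|^2]. It is nonpositive
    at the values [g z] and [h z], and zero at the value of the kernel. *)
Lemma kernel_extreme (lam : R) (x : C) : 0 < cos lam -> Cmod x = 1 ->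
  Ext (P_lambda lam) (fun z : unit_disc => p_lambda lam (x * z)%C).
Proof.
intros Hc Hx; split.
{ apply (P_lambda_subordinate lam (fun z => x * z)%C Hc).
  - intros z _; apply cdiff_mult; [apply cdiff_const|apply cdiff_id].
  - ring.
  - intros z Hz; rewrite Cmod_mult, Hx; lra. }
intros g h t Hg Hh Ht E; apply functional_extensionality; intros [z Hz].
destruct (P_lambda_schur lam g Hc Hg) as [u [_ [bu Eu]]].
destruct (P_lambda_schur lam h Hc Hh) as [v [_ [bv Ev]]].
apply (f_equal (fun k => k (exist _ z Hz : unit_disc))) in E; unfold combination in E.
specialize (Eu (exist _ z Hz)); specialize (Ev (exist _ z Hz)).
specialize (bu z Hz); specialize (bv z Hz).
change (unit_disc_val (exist _ z Hz)) with z in *.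
assert (zp := Cmod_ge_0 z).
assert (ineq : forall w, Cmod w <= 1 -> Cmod (p_lambda lam (z * w) - 1) ^ 2
     <= Cmod z ^ 2 * Cmod (p_lambda lam (z * w) + expi (-2 * lam)) ^ 2).
{ intros w Hw; assert (wp := Cmod_ge_0 w).
  rewrite p_lambda_eqn by (rewrite Cmod_mult; nra).
  rewrite !Cmod_mult, !Rpow_mult_distr.
  apply Rmult_le_compat_r; [apply pow2_ge_0|].
  rewrite <- (Rmult_1_r (Cmod z ^ 2)) at 2; apply Rmult_le_compat_l; [apply pow2_ge_0|nra]. }
assert (eqn : Cmod (p_lambda lam (x * z) - 1) ^ 2
     = Cmod z ^ 2 * Cmod (p_lambda lam (x * z) + expi (-2 * lam)) ^ 2).
{ rewrite p_lambda_eqn by (rewrite Cmod_mult, Hx; lra); rewrite !Cmod_mult, Hx; ring. }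
assert (I1 := ineq _ bu); assert (I2 := ineq _ bv).
rewrite <- Eu in I1; rewrite <- Ev in I2; rewrite E in eqn.
set (A := g (exist _ z Hz)) in *; set (B := h (exist _ z Hz)) in *.
set (s := Cmod z ^ 2) in *.
assert (s1 : 0 < 1 - s) by (unfold s; assert (0 < (1 - Cmod z) * (1 + Cmod z)) by (apply Rmult_lt_0_compat; lra); lra).
(* N (t A + (1 - t) B) = t N A + (1 - t) N B - t (1 - t) (1 - s) |A - B|^2 *)
assert (D : t * (1 - t) * (1 - s) * Cmod (A - B) ^ 2 <= 0).
{ clearbody A B s; clear - I1 I2 eqn Ht.
  rewrite !Cmod2_alt in *.
  generalize dependent (expi (-2 * lam)); intros [e1 e2]; destruct A as [a1 a2], B as [b1 b2].
  unfold Re, Im; simpl; intros; nra. }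
assert (0 < t * (1 - t) * (1 - s)) by (apply Rmult_lt_0_compat; [nra|exact s1]).
assert (AB : Cmod (A - B) = 0).
{ destruct (Cmod_ge_0 (A - B)) as [T|T]; [|now symmetry].
  assert (0 < t * (1 - t) * (1 - s) * Cmod (A - B) ^ 2) by (apply Rmult_lt_0_compat, pow_lt; assumption); lra. }
apply Cmod_eq_0 in AB; replace A with (A - B + B)%C by ring; rewrite AB; ring.
Qed.

(** Let [m] be the Herglotz measure of [(1 + z w) / (1 - z w)], with [w0] the
    value of [w] at 0. This is the Herglotz integral of the signed measure with
    density [Re (a x)] minus its mean value, with respect to
    [m]. Such densities are bounded, so small multiples can be added to [m] while
    keeping it a probability measure. *)
Definition variation (a w0 z w : C) : C :=
  ((a * z + Cconj a * w - Cconj a * w0 - a * Cconj w0 * (z * w)) / (1 - z * w))%C.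

(** Over the common denominator, the claim reduces to
    [x (1 - y^2) + y (1 - x^2) <= 1 - x^2 y^2] for [x = |z|] and [y = |w|], where
    the difference of the two sides is [(1 - x) (1 - y) (1 - x y)]. *)
Lemma Re_variation (a w0 z w : C) : Cmod a = 1 -> Cmod w0 <= 1 -> Cmod w <= 1 -> Cmod z < 1 ->
  Rabs (Re (variation a w0 z w)) <= 2 * ((1 - Cmod (z * w) ^ 2) / Cmod (1 - z * w) ^ 2).
Proof.
intros Ha H0 Hw Hz.
assert (zp := Cmod_ge_0 z); assert (wp := Cmod_ge_0 w).
assert (Hzw : Cmod (z * w) < 1) by (rewrite Cmod_mult; nra).
assert (n := one_minus_neq0 _ Hzw).
unfold variation; rewrite Re_div by exact n.
assert (dp : 0 < Cmod (1 - z * w) ^ 2) by (now apply pow_lt, Cmod_gt_0).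
unfold Rdiv; rewrite Rabs_mult, <- Rmult_assoc, (Rabs_pos_eq (/ _)) by (apply Rlt_le, Rinv_0_lt_compat, dp).
apply Rmult_le_compat_r; [apply Rlt_le, Rinv_0_lt_compat, dp|].
replace (Re ((a * z + Cconj a * w - Cconj a * w0 - a * Cconj w0 * (z * w)) * Cconj (1 - z * w)))
  with (Re (a * z) * (1 - Cmod w ^ 2) + Re (Cconj a * w) * (1 - Cmod z ^ 2)
        - Re (Cconj a * w0) * (1 - Cmod z ^ 2 * Cmod w ^ 2)).
2:{ rewrite !Cmod2_alt; destruct a as [a1 a2], w0 as [u1 u2], z as [z1 z2], w as [w1 w2].
    unfold Re, Im, Cconj, Cmult, Cminus, Cplus, Copp, RtoC; simpl; ring. }
assert (R1 := re_le_Cmod (a * z)); assert (R2 := re_le_Cmod (Cconj a * w)).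
assert (R3 := re_le_Cmod (Cconj a * w0)).
rewrite Cmod_mult, Ha, Rmult_1_l in R1; rewrite Cmod_mult, Cmod_conj, Ha, Rmult_1_l in R2, R3.
rewrite Cmod_mult, Rpow_mult_distr.
apply Rabs_le_between in R1; apply Rabs_le_between in R2; apply Rabs_le_between in R3.
set (A := Re (a * z)) in *; set (B := Re (Cconj a * w)) in *; set (K := Re (Cconj a * w0)) in *.
set (x := Cmod z) in *; set (y := Cmod w) in *.
assert (x2 : 0 <= 1 - x ^ 2) by nra; assert (y2 : 0 <= 1 - y ^ 2) by nra.
assert (xy : 0 <= 1 - x ^ 2 * y ^ 2) by nra.
assert (key : x * (1 - y ^ 2) + y * (1 - x ^ 2) <= 1 - x ^ 2 * y ^ 2).
{ assert (0 <= (1 - x) * (1 - y) * (1 - x * y)) by (repeat apply Rmult_le_pos; nra); nra. }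
assert (B1 : Rabs (A * (1 - y ^ 2)) <= x * (1 - y ^ 2)).
{ rewrite Rabs_mult, (Rabs_pos_eq (1 - y ^ 2)) by exact y2.
  apply Rmult_le_compat_r; [exact y2|]; apply Rabs_le_between; exact R1. }
assert (B2 : Rabs (B * (1 - x ^ 2)) <= y * (1 - x ^ 2)).
{ rewrite Rabs_mult, (Rabs_pos_eq (1 - x ^ 2)) by exact x2.
  apply Rmult_le_compat_r; [exact x2|]; apply Rabs_le_between; exact R2. }
assert (B3 : Rabs (K * (1 - x ^ 2 * y ^ 2)) <= 1 * (1 - x ^ 2 * y ^ 2)).
{ rewrite Rabs_mult, (Rabs_pos_eq (1 - x ^ 2 * y ^ 2)) by exact xy.
  apply Rmult_le_compat_r; [exact xy|]; apply Rabs_le_between; lra. }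
apply Rabs_le_between in B1; apply Rabs_le_between in B2; apply Rabs_le_between in B3.
apply Rabs_le_between; lra.
Qed.

(** [p_lambda lam z] is [cos lam * Cconj (expi lam)] times [(1 + z) / (1 - z)]
    plus a constant, whence the factor of the variation. With [1 / 4] the variation
    takes away at most half of the real part of [expi lam * f]. *)
Lemma variation_P_lambda (lam : R) (w : C -> C) (a : C) (k : R) : 0 < cos lam -> Cmod a = 1 ->
  (forall z, Cmod z < 1 -> cdiff w z) -> (forall z, Cmod z < 1 -> Cmod (w z) <= 1) ->
  Rabs k = 1 / 4 ->
  P_lambda lam (fun z : unit_disc => p_lambda lam (z * w z)
     + RtoC (k * cos lam) * Cconj (expi lam) * variation a (w 0%C) z (w z))%C.
Proof.
intros Hc Ha dw bw Hk.
assert (zw : forall z, Cmod z < 1 -> Cmod (z * w z) < 1).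
{ intros z Hz; rewrite Cmod_mult; assert (T1 := bw z Hz); assert (T2 := Cmod_ge_0 z).
  assert (T3 := Cmod_ge_0 (w z)); nra. }
assert (w0 : Cmod (w 0%C) <= 1) by (apply bw; rewrite Cmod_0; lra).
assert (dzw : forall z, Cmod z < 1 -> cdiff (fun z => z * w z)%C z).
{ intros z Hz; apply cdiff_mult; [apply cdiff_id|now apply dw]. }
apply (P_lambda_intro lam (fun z => p_lambda lam (z * w z)
     + RtoC (k * cos lam) * Cconj (expi lam) * variation a (w 0%C) z (w z))%C).
- intros z Hz; apply cdiff_plus.
  + apply (cdiff_comp (fun z => z * w z)%C); [now apply dzw|now apply cdiff_p_lambda, zw].
  + apply cdiff_mult; [apply cdiff_const|].
    apply cdiff_div; [| |now apply one_minus_neq0, zw].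
    * repeat first [apply cdiff_minus|apply cdiff_plus]; apply cdiff_mult; auto using cdiff_const, cdiff_id.
    * apply cdiff_minus; [apply cdiff_const|now apply dzw].
- rewrite Cmult_0_l, p_lambda_0; unfold variation.
  replace (a * 0 + Cconj a * w 0%R - Cconj a * w 0%R - a * Cconj (w 0%R) * (0 * w 0%R))%C with (RtoC 0) by ring.
  unfold Cdiv; ring.
- intros z Hz.
  set (v := variation a (w 0%C) z (w z)).
  replace (expi lam * (p_lambda lam (z * w z) + RtoC (k * cos lam) * Cconj (expi lam) * v))%C
    with (expi lam * p_lambda lam (z * w z) + RtoC (k * cos lam) * ((expi lam * Cconj (expi lam)) * v))%C by ring.
  rewrite expi_conj.
  assert (E : forall (p q : C) (m : R), Re (p + RtoC m * (1 * q)) = Re p + m * Re q).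
  { intros [p1 p2] [q1 q2] m; unfold Re; simpl; ring. }
  rewrite E, Re_p_lambda by now apply zw.
  assert (V := Re_variation a (w 0%C) z (w z) Ha w0 (bw z Hz) Hz); fold v in V.
  assert (D := poisson_kernel_gt0 _ (zw z Hz)).
  set (d := (1 - Cmod (z * w z) ^ 2) / Cmod (1 - z * w z) ^ 2) in *.
  replace (cos lam * d + k * cos lam * Re v) with (cos lam * (d + k * Re v)) by ring.
  apply Rmult_lt_0_compat; [exact Hc|].
  assert (T : Rabs (k * Re v) <= d / 2) by (rewrite Rabs_mult, Hk; lra).
  apply Rabs_le_between in T; lra.
Qed.

(** The two perturbations [k = 1/4] and [k = -1/4] have mean [f], so they
    coincide. *)
Lemma extreme_variation_0 (lam : R) (f : unit_disc -> C) (w : C -> C) (a : C) :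
  0 < cos lam -> Cmod a = 1 -> Ext (P_lambda lam) f ->
  (forall z, Cmod z < 1 -> cdiff w z) -> (forall z, Cmod z < 1 -> Cmod (w z) <= 1) ->
  (forall z : unit_disc, f z = p_lambda lam (z * w z)%C) ->
  forall z, Cmod z < 1 ->
    (a * z + Cconj a * w z)%C = (Cconj a * w 0%C + a * Cconj (w 0%C) * (z * w z))%C.
Proof.
intros Hc Ha [_ Hext] dw bw Ef z Hz.
assert (G : forall k, Rabs k = 1 / 4 -> _) by exact (fun k => variation_P_lambda lam w a k Hc Ha dw bw).
assert (E := Hext _ _ (1 / 2) (G (1 / 4) ltac:(rewrite Rabs_pos_eq; lra))
                  (G (- (1 / 4)) ltac:(rewrite Rabs_Ropp, Rabs_pos_eq; lra)) ltac:(lra)).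
assert (E' := E ltac:(apply functional_extensionality; intros y; rewrite Ef; unfold combination;
  replace (1 - 1 / 2) with (1 / 2) by lra; replace (- (1 / 4) * cos lam) with (- (1 / 4 * cos lam)) by lra;
  rewrite RtoC_opp; replace (RtoC (1 / 2)) with (/ 2)%C by (rewrite <- RtoC_inv; f_equal; lra); field;
  intros X; apply RtoC_inj in X; lra)).
apply (f_equal (fun k => k (exist _ z Hz : unit_disc))) in E'; cbv beta in E'.
change (unit_disc_val (exist _ z Hz)) with z in E'.
set (v := variation a (w 0%C) z (w z)) in *.
replace (- (1 / 4) * cos lam) with (- (1 / 4 * cos lam)) in E' by lra; rewrite RtoC_opp in E'.
assert (V : v = 0%C).
{ assert (T : (RtoC (2 * (1 / 4 * cos lam)) * Cconj (expi lam) * v)%C = 0%C).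
  { set (m := (RtoC (1 / 4 * cos lam) * Cconj (expi lam) * v)%C) in *.
    transitivity (m + m)%C; [unfold m; rewrite RtoC_mult; ring|].
    transitivity ((p_lambda lam (z * w z) + m) - (p_lambda lam (z * w z) + - RtoC (1 / 4 * cos lam) * Cconj (expi lam) * v))%C.
    - unfold m; ring.
    - rewrite E'; ring. }
  apply (f_equal Cmod) in T; rewrite !Cmod_mult, Cmod_conj, Cmod_expi, Cmod_R, Cmod_0 in T.
  rewrite Rabs_pos_eq in T by lra; apply Cmod_eq_0; nra. }
unfold v, variation in V.
assert (n : (1 - z * w z)%C <> 0%C).
{ apply one_minus_neq0; rewrite Cmod_mult; assert (T1 := bw z Hz); assert (T2 := Cmod_ge_0 z).
  assert (T3 := Cmod_ge_0 (w z)); nra. }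
apply (f_equal (fun y => y * (1 - z * w z))%C) in V.
rewrite Cmult_0_l in V; unfold Cdiv in V; rewrite <- Cmult_assoc, Cinv_l, Cmult_1_r in V by exact n.
set (u := (Cconj a * w 0%C + a * Cconj (w 0%C) * (z * w z))%C).
transitivity (a * z + Cconj a * w z - Cconj a * w 0%C - a * Cconj (w 0%C) * (z * w z) + u)%C; [unfold u; ring|].
rewrite V; ring.
Qed.

Theorem theorem3 (lam : R) (hlam : (- (PI / 2) < lam < PI / 2)%R) :
  forall f : unit_disc -> C,
    Ext (P_lambda lam) f <->
    exists x : C, Cmod x = 1%R /\ f = (fun z : unit_disc => p_lambda lam (x * z)%C).
Proof.
intros f; assert (Hc : 0 < cos lam) by (apply cos_gt_0; lra).
split; [|intros [x [Hx ->]]; now apply kernel_extreme].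
intros Hf; destruct (P_lambda_schur lam f Hc (proj1 Hf)) as [w [dw [bw Ef]]].
assert (V := fun a Ha => extreme_variation_0 lam f w a Hc Ha Hf dw bw Ef).
assert (two : (RtoC 2) <> 0%C) by (intros E; apply RtoC_inj in E; lra).
set (w0 := w 0%C) in *.
assert (both : forall z, Cmod z < 1 -> w z = w0 /\ z = (Cconj w0 * (z * w z))%C).
{ intros z Hz.
  assert (V1 := V 1%C Cmod_1 z Hz); assert (V2 := V Ci Cmod_Ci z Hz).
  replace (Cconj 1) with (RtoC 1) in V1 by (unfold Cconj, RtoC; simpl; f_equal; ring).
  replace (Cconj Ci) with (- Ci)%C in V2 by (unfold Cconj, Copp, Ci; simpl; f_equal; ring).
  (* the identity for a = i, multiplied by -i *)
  assert (V2' : (z - w z)%C = (- w0 + Cconj w0 * (z * w z))%C).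
  { assert (T := f_equal (fun y => - Ci * y)%C V2); cbv beta in T.
    assert (ii : (Ci * Ci = - (1))%C) by (unfold Ci, Cmult, Copp, RtoC; simpl; f_equal; ring).
    transitivity (- (Ci * Ci) * (z - w z))%C; [rewrite ii; ring|].
    transitivity (- (Ci * Ci) * (- w0 + Cconj w0 * (z * w z)))%C; [|rewrite ii; ring].
    transitivity (- Ci * (Ci * z + - Ci * w z))%C; [ring|]; rewrite T; ring. }
  assert (S : (2 * w z)%C = (2 * w0)%C).
  { transitivity ((1 * z + 1 * w z) - (z - w z))%C; [ring|]; rewrite V1, V2'; ring. }
  assert (D : (2 * z)%C = (2 * (Cconj w0 * (z * w z)))%C).
  { transitivity ((1 * z + 1 * w z) + (z - w z))%C; [ring|]; rewrite V1, V2'; ring. }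
  split.
  - apply (f_equal (fun y => / 2 * y)%C) in S; rewrite !Cmult_assoc, !Cinv_l, !Cmult_1_l in S by exact two; exact S.
  - apply (f_equal (fun y => / 2 * y)%C) in D; rewrite !(Cmult_assoc (/ 2)), !Cinv_l, !Cmult_1_l in D by exact two; exact D. }
exists w0; split.
- assert (half : Cmod (RtoC (1 / 2)) = 1 / 2) by (rewrite Cmod_R; apply Rabs_pos_eq; lra).
  destruct (both (RtoC (1 / 2))) as [E1 E2]; [rewrite half; lra|].
  rewrite E1 in E2; apply (f_equal Cmod) in E2.
  rewrite !Cmod_mult, Cmod_conj, half in E2; assert (T := Cmod_ge_0 w0); nra.
- apply functional_extensionality; intros [z Hz]; rewrite Ef.
  change (unit_disc_val (exist _ z Hz)) with z; rewrite (proj1 (both z Hz)); f_equal; ring.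
Qed.
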